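(* Let $K\subset\mathbb{C}$ be compact, connected and full, with more than one point, and let $Q\subset\mathbb{R}/\mathbb{Z}$ be a countable set of angles such that all external rays of $K$ at angles in $Q$ land; fibers are defined with respect to $Q$. Suppose that the landing points of all the rays with angles in $Q$ have trivial fibers. Then the fibers of any two points of $K$ are either equal or disjoint, and $K$ splits into fibers as equivalence classes of points with coinciding fibers. In that case, there is a map from external angles to fibers of $K$ via impressions of external rays (sending each $\theta\in\mathbb{R}/\mathbb{Z}$ to the fiber containing the impression of the external ray at angle $\theta$). This map is surjective onto the set of fibers meeting $\partial K$.
   Context: A compact set $K\subset\mathbb{C}$ is full if $\mathbb{C}\setminus K$ has no bounded components. Let $\Phi_K:\overline{\mathbb{C}}\setminus K\to\overline{\mathbb{C}}\setminus\overline{\mathbb{D}}$ be the Riemann map fixing $\infty$ with positive real derivative there. The external ray at angle $\theta\in\mathbb{R}/\mathbb{Z}$ is $R_K(\theta)=\Phi_K^{-1}(\{re^{2\pi i\theta}:r>1\})$. Its limit set is $L_K(\theta)=\overline{R_K(\theta)}\cap K$, and the ray lands if its limit set is a single point (its landing point). The impression of the ray is $I_K(\theta)=\bigcap_{\varepsilon>0}\overline{\bigcup_{|\varphi-\theta|<\varepsilon}L_K(\varphi)}$; equivalently, it is the set of all limits of $\Phi_K^{-1}(re^{2\pi i\varphi})$ as $r\searrow1$, $\varphi\to\theta$. A separation line is either two external rays with angles in $Q$ landing at a common point of $\partial K$, together with this point, or two external rays with angles in $Q$ landing at different points, together with these landing points and a simple curve in the interior of $K$ connecting the two landing points (the curve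 lies in the interior of $K$ and converges at its two ends to the two landing points). Two points $z,z'\in K$ can be separated if there is a separation line $\gamma$ avoiding $z$ and $z'$ such that $z,z'$ lie in different connected components of $\mathbb{C}\setminus\gamma$. The fiber of $z\in K$ is the connected component containing $z$ of the set of all points of $K$ which cannot be separated from $z$. The fiber of $z$ is trivial if it equals $\{z\}$. *)

(* Defs.v *)
From HB Require Import structures.
From mathcomp Require Import all_boot all_order all_algebra.
From mathcomp Require Import complex.
From mathcomp Require Import all_classical all_reals all_analysis.

Set Implicit Arguments.
Unset Strict Implicit.
Unset Printing Implicit Defensive.

Import Order.TTheory GRing.Theory Num.Theory.
Import numFieldNormedType.Exports.

Local Open Scope classical_set_scope.
Local Open Scope ring_scope.
Local Open Scope complex_scope.
Local Open Scope quotient_scope.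

(* The complex plane with its usual topology.  Only the regular algebra [^o]
   carries the normed-module structure.  In the (partial) order of [R[i]],
   [0 < z] means that [z] is real and positive. *)
Notation plane R := ((R[i])^o).

(** Angles: the quotient group R/Z *)

Section Angles.
Variable R : realType.

Definition angle_rel (x y : R) : bool := (x - y) \is a Num.int.

Lemma angle_rel_refl : reflexive angle_rel.
Proof. by move=> x; rewrite /angle_rel subrr rpred0. Qed.

Lemma angle_rel_sym : symmetric angle_rel.
Proof. by move=> x y; rewrite /angle_rel -rpredN opprB. Qed.

Lemma angle_rel_trans : transitive angle_rel.
Proof.
move=> y x z; rewrite /angle_rel => xy yz.
by rewrite -(subrK y x) -addrA rpredD.
Qed.

Canonical angle_equiv :=
  EquivRel angle_rel angle_rel_refl angle_rel_sym angle_rel_trans.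

Definition angle := {eq_quot angle_equiv}.

Definition angle_close (e : R) (phi theta : angle) : Prop :=
  exists x y : R,
    [/\ \pi_angle x = phi, \pi_angle y = theta & `|x - y| < e].

End Angles.

Section Rays.
Variable R : realType.
Implicit Types (K : set (plane R)) (Phi : plane R -> plane R).

Definition full K : Prop :=
  forall z, ~ K z -> ~ bounded_set (connected_component (~` K) z).

Definition boundary K : set (plane R) := closure K `\` interior K.

(* A map fixing infinity, read in the coordinate u = 1/z there. *)
Definition at_infinity Phi : plane R -> plane R :=
  fun u => if u == 0 then 0 else (Phi u^-1)^-1.

(* The values of [Phi] on [K] are irrelevant.  [derivable _ z 1] over the
   scalar field [R[i]] is complex differentiability at [z]. *)
Definition riemann_map K Phi : Prop :=
  [/\ forall z, ~ K z -> derivable Phi z 1,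
      set_bij (~` K) [set w | 1 < `|w|] Phi,
      derivable (at_infinity Phi) 0 1
    & 0 < (at_infinity Phi)^`()%classic 0].

Definition expi2pi (x : R) : plane R :=
  cos (2 * pi * x) +i* sin (2 * pi * x).

Definition ray K Phi (theta : angle R) : set (plane R) :=
  [set z | ~ K z /\ exists x r : R,
    [/\ \pi_(angle R) x = theta, 1 < r & Phi z = r%:C * expi2pi x]].

Definition limit_set K Phi (theta : angle R) : set (plane R) :=
  closure (ray K Phi theta) `&` K.

Definition lands_at K Phi (theta : angle R) (p : plane R) : Prop :=
  limit_set K Phi theta = [set p].

Definition lands K Phi (theta : angle R) : Prop :=
  exists p, lands_at K Phi theta p.

Definition impression K Phi (theta : angle R) : set (plane R) :=
  \bigcap_(e in [set e : R | 0 < e])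
    closure (\bigcup_(phi in [set phi | angle_close e phi theta])
               limit_set K Phi phi).

End Rays.

Section Fibers.
Variables (R : realType) (K : set (plane R)) (Phi : plane R -> plane R).
Variable Q : set (angle R).
Implicit Types (z w p : plane R) (theta : angle R) (g : set (plane R)).

Definition ray_pair_line g : Prop :=
  exists theta1 theta2 p,
    [/\ Q theta1 /\ Q theta2, theta1 <> theta2, boundary K p,
        lands_at K Phi theta1 p /\ lands_at K Phi theta2 p
      & g = ray K Phi theta1 `|` ray K Phi theta2 `|` [set p]].

(* [c] is a simple arc from p1 to p2 whose open part lies in the interior
   of K. *)
Definition interior_arc (c : R -> plane R) p1 p2 : Prop :=
  [/\ {within `[0, 1], continuous c}, {in `[0, 1] &, injective c},
      c 0 = p1, c 1 = p2
    & forall t, 0 < t < 1 -> interior K (c t)].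

Definition ray_arc_line g : Prop :=
  exists theta1 theta2 p1 p2 c,
    [/\ Q theta1 /\ Q theta2, p1 <> p2,
        lands_at K Phi theta1 p1 /\ lands_at K Phi theta2 p2,
        interior_arc c p1 p2
      & g = ray K Phi theta1 `|` ray K Phi theta2 `|` c @` `[0, 1]].

Definition separation_line g : Prop := ray_pair_line g \/ ray_arc_line g.

Definition separated z w : Prop :=
  exists g, [/\ separation_line g, ~ g z, ~ g w
              & ~ connected_component (~` g) z w].

Definition fiber z : set (plane R) :=
  connected_component [set w | K w /\ ~ separated z w] z.

Definition trivial_fiber z : Prop := fiber z = [set z].

Definition fibers : set (set (plane R)) := fiber @` K.

End Fibers.

(* Main.v *)
Require Import Defs.
From mathcomp Require Import all_boot all_order all_algebra.
From mathcomp Require Import complex.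
From mathcomp Require Import all_classical all_reals all_analysis.
From mathcomp Require Import ring lra.
Import Order.TTheory GRing.Theory Num.Theory.
Import numFieldNormedType.Exports.
Local Open Scope classical_set_scope.
Local Open Scope ring_scope.
Local Open Scope quotient_scope.
Set Implicit Arguments.
Unset Strict Implicit.
Unset Printing Implicit Defensive.

(** Two facts carry the proof.

    Points of one fiber are never separated from each other
    ([fiber_not_separated]).  Let F be the fiber of z and suppose that a
    separation line g separates two points of F.  If g misses z, it separates z
    from one of the two, which is absurd.  If g meets z at a landing point, F is
    trivial by hypothesis.  The remaining possibility is that z lies on the arc of
    g, in the interior of K.  The arc contains no open set, so there is a point y
    near z off g, and a homeomorphism of the plane that is the identity outside a
    small disc and takes y to z moves g to a separation line that misses z and
    separates the same two points ([move_separation_line]).  Hence F, being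
    connected, is contained in the fiber of each of its points, and fibers that
    meet are equal.

    The impression of a ray lies in one fiber ([prime_impression_in_fiber]).  It is
    contained in the set of limits of the inverse Riemann map along thin sectors
    about the angle, a nested intersection of compact connected sets and therefore
    connected.  A separation line that does not use the ray avoids a thin sector,
    and the sector joins any two points of the impression off the line.  If the
    angle is in Q, every line that uses the ray contains its landing point, so no
    point of the impression is separated from the landing point.  Finally each
    boundary point of K belongs to some impression, because the angles of points
    outside K that tend to it accumulate.

    The second part needs the inverse of the Riemann map to be continuous, also at
    infinity, and the first one that an arc contains no open set.  Both follow from
    invariance of domain in the plane ([open_injective]), which is proved with
    continuous square roots in place of the winding number: the odd map
    f (c + r x) - f (c - r x) on the unit circle has no continuous square root,
    whereas an image that missed points near f c would provide one by
    homotopies. *)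

(** * The plane: modulus, limits and compact sets *)

Lemma continuous_at_filter (T U : topologicalType) (h : T -> U) (z : T) :
  (forall F : set_system T, Filter F ->
     (fun x => x) @ F --> z -> h @ F --> h z) -> {for z, continuous h}.
Proof. by move=> /(_ (nbhs z) (nbhs_filter z)); apply; exact: cvg_id. Qed.

Section Plane.
Variable R : realType.
Local Notation C := (plane R).
Local Notation normc := (@ComplexField.Normc.normc R).
Local Notation Re := (@complex.Re R).
Local Notation Im := (@complex.Im R).
Implicit Types (z w : C) (A : set C).

Lemma normE z : `|z| = (normc z)%:C%C.
Proof. by []. Qed.

Lemma normc_ge0 z : 0 <= normc z.
Proof. by have := normr_ge0 z; rewrite normE ler0c. Qed.

Lemma normc_gt0 z : (0 < normc z) = (z != 0).
Proof. by have := normr_gt0 z; rewrite normE ltcR => ->. Qed.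

Lemma normc0 : normc (0 : C) = 0.
Proof. exact: ComplexField.Normc.normc0. Qed.

Lemma normc_add z w : normc (z + w) <= normc z + normc w.
Proof. by have := ler_normD z w; rewrite !normE -rmorphD lecR. Qed.

Lemma normc_opp z : normc (- z) = normc z.
Proof. by apply: complexI; rewrite -!normE normrN. Qed.

Lemma normc_sub z w : normc (z - w) = normc (w - z).
Proof. by rewrite -normc_opp opprB. Qed.

Lemma normc_mul z w : normc (z * w) = normc z * normc w.
Proof. exact: ComplexField.Normc.normcM. Qed.

Lemma normcV z : normc z^-1 = (normc z)^-1.
Proof. exact: ComplexField.Normc.normcV. Qed.

Lemma normc_real (a : R) : normc (a%:C)%C = `|a|.
Proof. by rewrite /= expr0n /= addr0 sqrtr_sqr. Qed.

Lemma Re_le z : `|Re z| <= normc z.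
Proof. by have := normc_ge_Re z; rewrite normE lecR. Qed.

Lemma Im_le z : `|Im z| <= normc z.
Proof.
case: z => a b /=; rewrite -sqrtr_sqr ler_wsqrtr // lerDr.
exact: sqr_ge0.
Qed.

Lemma normc_le z : normc z <= `|Re z| + `|Im z|.
Proof.
case: z => a b /=.
rewrite -[leRHS]ger0_norm ?addr_ge0// -[leRHS]sqrtr_sqr ler_wsqrtr //.
rewrite sqrrD !real_normK ?num_real// addrAC lerDl mulrn_wge0//.
Qed.

Lemma nbhs_plane z A :
  nbhs z A <-> exists2 e : R, 0 < e & forall w, normc (z - w) < e -> A w.
Proof.
split.
  move/nbhs_ballP => -[e /= e0 eA].
  exists (Re e); first by move: e0; rewrite ltcE /= => /andP[].
  move=> w zw; apply: eA; rewrite -ball_normE /= normE.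
  by move: e0; rewrite !ltcE /= => /andP[-> _].
move=> [e e0 eA]; apply/nbhs_ballP; exists (e%:C)%C => /=; first by rewrite ltcR.
by move=> w; rewrite -ball_normE /= normE ltcR; exact: eA.
Qed.

Lemma cvg_plane (T : Type) (F : set_system T) {FF : Filter F} (f : T -> C) z :
  (forall e : R, 0 < e -> \forall x \near F, normc (z - f x) < e) ->
  f @ F --> z.
Proof.
move=> h A /nbhs_plane[e e0 eA].
by have := h e e0; apply: filterS => x; exact: eA.
Qed.

Lemma cvg_planeP (T : Type) (F : set_system T) {FF : Filter F} (f : T -> C) z :
  f @ F --> z ->
  (forall e : R, 0 < e -> \forall x \near F, normc (z - f x) < e).
Proof.
move=> h e e0; apply: (h [set w | normc (z - w) < e]).
by apply/nbhs_plane; exists e.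
Qed.

Lemma real_cvg (T : Type) (F : set_system T) {FF : Filter F} (f : T -> R) a :
  (forall e : R, 0 < e -> \forall x \near F, `|a - f x| < e) -> f @ F --> a.
Proof. by move=> h; apply/cvgrPdist_lt. Qed.

Lemma normc_continuous : continuous (normc : C -> R).
Proof.
move=> z; apply: (@real_cvg _ (nbhs z)) => e e0.
apply/nbhs_plane; exists e => // w; apply: le_lt_trans.
rewrite ler_norml; apply/andP; split.
  by have := normc_add (w - z) z; rewrite subrK (normc_sub w); lra.
by have := normc_add (z - w) w; rewrite subrK; lra.
Qed.

Lemma Re_continuous : continuous (Re : C -> R).
Proof.
move=> z; apply: (@real_cvg _ (nbhs z)) => e e0.
apply/nbhs_plane; exists e => // w; apply: le_lt_trans.
by have := Re_le (z - w); case: z w => a b [c d].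
Qed.

Lemma Im_continuous : continuous (Im : C -> R).
Proof.
move=> z; apply: (@real_cvg _ (nbhs z)) => e e0.
apply/nbhs_plane; exists e => // w; apply: le_lt_trans.
by have := Im_le (z - w); case: z w => a b [c d].
Qed.

Lemma cvg_complex (T : Type) (F : set_system T) {FF : Filter F}
    (f g : T -> R) (a b : R) :
  f @ F --> a -> g @ F --> b ->
  (fun x => (f x +i* g x)%C : C) @ F --> ((a +i* b)%C : C).
Proof.
move=> fa gb; apply: cvg_plane => e e0.
have e20 : 0 < e / 2 by lra.
move/cvgrPdist_lt/(_ _ e20) in fa; move/cvgrPdist_lt/(_ _ e20) in gb.
apply: filterS2 fa gb => x h1 h2.
by apply: le_lt_trans (normc_le _) _ => /=; lra.
Qed.

Lemma cvg_real_complex (T : Type) (F : set_system T) {FF : Filter F}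
    (f : T -> R) (a : R) :
  f @ F --> a -> (fun x => (f x)%:C%C : C) @ F --> (a%:C%C : C).
Proof. by move=> fa; apply: cvg_complex => //; exact: cvg_cst. Qed.

Lemma plane_hausdorff : hausdorff_space C.
Proof. exact: norm_hausdorff. Qed.

(** Heine-Borel in the plane, via the box that contains the disc. *)
Lemma compact_disc (M : R) : compact [set z : C | normc z <= M].
Proof.
pose f (p : R * R) : C := (p.1 +i* p.2)%C.
have cf : continuous f.
  move=> p; apply: cvg_complex; [exact: cvg_fst | exact: cvg_snd].
have cK : compact (f @` (`[- M, M] `*` `[- M, M])).
  apply: continuous_compact; first exact: continuous_subspaceT.
  by apply: compact_setX; exact: segment_compact.
apply: (subclosed_compact _ cK).
  have -> : [set z : C | normc z <= M] = (normc : C -> R) @^-1` [set x | x <= M] by [].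
  by apply: closed_comp; [move=> z _; exact: normc_continuous | exact: closed_le].
move=> [a b] zM; exists (a, b) => //; split; rewrite /= in_itv /= -ler_norml.
  exact: le_trans (Re_le (a +i* b)%C) zM.
exact: le_trans (Im_le (a +i* b)%C) zM.
Qed.

Lemma compact_plane A (M : R) :
  closed A -> (forall z, A z -> normc z <= M) -> compact A.
Proof. by move=> cA AM; apply: (subclosed_compact cA (@compact_disc M)). Qed.

End Plane.

(** * Continuous square roots along homotopies *)

Section SquareRoots.
Variable R : realType.
Local Notation C := (plane R).
Local Notation normc := (@ComplexField.Normc.normc R).
Local Notation Re := (@complex.Re R).
Local Notation Im := (@complex.Im R).
Implicit Types (z w : C).

(** The principal root, from the identity
    (w + |w|)^2 = w (2 Re w + 2 |w|). *)
Definition half_plane_sqrt w : C :=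
  (Num.sqrt (2 * (Re w + normc w)))^-1%:C%C * (w + (normc w)%:C%C).

Lemma half_plane_sqrtK w : 0 < Re w -> half_plane_sqrt w ^+ 2 = w.
Proof.
move=> w0; have n0 := normc_ge0 w.
have nE : normc w ^+ 2 = Re w ^+ 2 + Im w ^+ 2.
  by case: w {w0 n0} => a b /=; rewrite sqr_sqrtr// addr_ge0// sqr_ge0.
rewrite /half_plane_sqrt exprMn -rmorphXn /= exprVn sqr_sqrtr; last by nra.
have d0 : 2 * (Re w + normc w) != 0 by nra.
move: (normc w) nE n0 d0 => n; case: w w0 => a b /= a0 nE n0 d0.
rewrite expr2; apply/eqP; rewrite eq_complex /=; apply/andP; split; apply/eqP.
  rewrite mul0r subr0.
  have -> : (a + n) * (a + n) - (b + 0) * (b + 0)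
      = a * (2 * (a + n)) + (n ^+ 2 - (a ^+ 2 + b ^+ 2)) by ring.
  by rewrite nE subrr addr0 mulrC mulfK.
have -> : (a + n) * (b + 0) + (b + 0) * (a + n) = b * (2 * (a + n)) by ring.
by rewrite mul0r addr0 mulrC mulfK.
Qed.

Section Limits.
Variables (T : Type) (F : set_system T).
Context {FF : Filter F}.
Implicit Types (f g : T -> C).

Lemma cvg_planeD f g z w :
  f @ F --> z -> g @ F --> w -> (fun x => f x + g x) @ F --> (z + w : C).
Proof. exact: (@cvgD _ C). Qed.

Lemma cvg_planeN f z : f @ F --> z -> (fun x => - f x) @ F --> (- z : C).
Proof. exact: (@cvgN _ C). Qed.

Lemma cvg_planeB f g z w :
  f @ F --> z -> g @ F --> w -> (fun x => f x - g x) @ F --> (z - w : C).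
Proof. exact: (@cvgB _ C). Qed.

Lemma cvg_planeM f g z w :
  f @ F --> z -> g @ F --> w -> (fun x => f x * g x) @ F --> (z * w : C).
Proof. exact: (@cvgM R[i]). Qed.

Lemma cvg_planeV f z :
  z != 0 -> f @ F --> z -> (fun x => (f x)^-1) @ F --> (z^-1 : C).
Proof. exact: (@cvgV R[i]). Qed.

Lemma cvg_normc f z : f @ F --> z -> (fun x => normc (f x)) @ F --> normc z.
Proof. by move=> fz; apply: cvg_comp fz _; exact: normc_continuous. Qed.

Lemma cvg_Re f z : f @ F --> z -> (fun x => Re (f x)) @ F --> Re z.
Proof. by move=> fz; apply: cvg_comp fz _; exact: Re_continuous. Qed.

Lemma cvg_Im f z : f @ F --> z -> (fun x => Im (f x)) @ F --> Im z.
Proof. by move=> fz; apply: cvg_comp fz _; exact: Im_continuous. Qed.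

Lemma cvg_plane_comp (h : C -> C) f z :
  {for z, continuous h} -> f @ F --> z -> (fun x => h (f x)) @ F --> h z.
Proof. by move=> hz fz; apply: cvg_comp fz hz. Qed.

Lemma cvg_half_plane_sqrt f w : 0 < Re w -> f @ F --> w ->
  (fun x => half_plane_sqrt (f x)) @ F --> half_plane_sqrt w.
Proof.
move=> w0 fw; have n0 := normc_ge0 w.
apply: cvg_planeM.
  apply: cvg_real_complex; apply: cvgV.
    by rewrite gt_eqF// sqrtr_gt0; nra.
  apply: cvg_comp; last exact: sqrt_continuous.
  apply: cvgM; first exact: cvg_cst.
  by apply: cvgD; [exact: cvg_Re | exact: cvg_normc].
apply: (cvg_planeD fw); apply: cvg_real_complex; exact: cvg_normc.
Qed.

End Limits.

(** On a circle, a nowhere zero map has a continuous square root exactly when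
    its degree is even, so this property plays the part of a winding number
    modulo 2. *)
Definition has_sqrt (T : topologicalType) (X : set T) (g : T -> C) : Prop :=
  exists s : T -> C, forall x, X x -> {for x, continuous s} /\ s x ^+ 2 = g x.

(** A uniform continuity statement: near each point (x, t) two values of H
    differ by less than the modulus of one of them, and X x [0, 1] is compact. *)
Lemma homotopy_small_ratio (T : topologicalType) (X : set T) (H : T * R -> C) :
  compact X ->
  (forall x (t : R), X x -> 0 <= t <= 1 -> {for (x, t), continuous H}) ->
  (forall x (t : R), X x -> 0 <= t <= 1 -> H (x, t) <> 0) ->
  exists2 d : R, 0 < d & forall x (s t : R), X x -> 0 <= s <= 1 -> 0 <= t <= 1 ->
    `|s - t| < d -> normc (H (x, s) / H (x, t) - 1) < 1.
Proof.
move=> cX cH H0.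
have cXI : compact (X `*` (`[0, 1] : set R)).
  by apply: compact_setX => //; exact: segment_compact.
pose P (d : R) (p : T * R) := forall s, 0 <= s <= 1 -> `|s - p.2| < d ->
  normc (H (p.1, s) - H p) < normc (H p).
have : \forall d \near (0 : R)^'+, (X `*` (`[0, 1] : set R)) `<=` P d.
  move/compact_near_coveringP: cXI; apply => -[x t] [/= Xx].
  rewrite in_itv /= => t01.
  have m0 : 0 < normc (H (x, t)) by rewrite normc_gt0; apply/eqP; exact: H0.
  have e0 : 0 < normc (H (x, t)) / 3 by lra.
  have := cvg_planeP (cH x t Xx t01) e0.
  move=> [[U V] /= [Ux Vt] UVH].
  have /nbhs_ballP[e /= e1 eV] := Vt.
  have e2 : 0 < e / 2 by lra.
  exists ((U `*` ball t (e / 2)), [set d | d < e / 2]).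
    split => /=; last exact: nbhs_right_lt.
    by exists (U, ball t (e / 2)) => //; split => //=; exact: nbhsx_ballx.
  move=> [[x' t'] d] /= [[Ux' tt'] de] s s01 st'.
  have h1 : normc (H (x, t) - H (x', t')) < normc (H (x, t)) / 3.
    apply: (UVH (x', t')); split => //=; apply: eV; apply: le_ball tt'.
    by rewrite ler_pdivrMr//; lra.
  have h2 : normc (H (x, t) - H (x', s)) < normc (H (x, t)) / 3.
    apply: (UVH (x', s)); split => //=; apply: eV.
    move: tt'; rewrite -ball_normE /= => tt'.
    have := ler_normD (t - t') (t' - s); rewrite subrKA (distrC t' s); lra.
  have := normc_add (H (x', s) - H (x, t)) (H (x, t) - H (x', t')).
  rewrite subrKA (normc_sub _ (H (x, t))).
  have := normc_add (H (x, t) - H (x', t')) (H (x', t')).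
  by rewrite subrK; lra.
move=> nearP.
have [d [d0 dP]] : exists d : R, 0 < d /\ (X `*` (`[0, 1] : set R)) `<=` P d.
  have [d [d0 dP]] : exists d, ((fun d : R => 0 < d) `&`
      (fun d => X `*` (`[0, 1] : set R) `<=` P d)) d.
    by apply: (@filter_ex _ (0 : R)^'+); apply: filterI nearP; exact: nbhs_right_gt.
  by exists d.
exists d => // x s t Xx s01 t01 st.
have Hn0 : H (x, t) != 0 by apply/eqP; exact: H0.
have -> : H (x, s) / H (x, t) - 1 = (H (x, s) - H (x, t)) / H (x, t) :> C.
  by rewrite mulrBl divff.
rewrite normc_mul normcV ltr_pdivrMr ?normc_gt0// mul1r.
by apply: (dP (x, t)) => //; split => //=; rewrite in_itv.
Qed.

(** A square root can be carried along a homotopy in the punctured plane: at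
    each of finitely many short steps it is multiplied by the principal root of
    the ratio of two consecutive maps, a ratio at distance less than 1 from 1. *)
Lemma has_sqrt_homotopy (T : topologicalType) (X : set T) (H : T * R -> C) :
  compact X ->
  (forall x (t : R), X x -> 0 <= t <= 1 -> {for (x, t), continuous H}) ->
  (forall x (t : R), X x -> 0 <= t <= 1 -> H (x, t) <> 0) ->
  has_sqrt X (fun x => H (x, 0)) -> has_sqrt X (fun x => H (x, 1)).
Proof.
move=> cX cH H0 s0.
have [d d0 dH] := homotopy_small_ratio cX cH H0.
have [n nd] : exists n : nat, n.+1%:R^-1 < d.
  have := near_infty_natSinv_lt (PosNum d0).
  by move=> [n _ /(_ n (leqnn _))] /=; exists n.
have step k : (k <= n.+1)%N -> has_sqrt X (fun x => H (x, k%:R / n.+1%:R)).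
  elim: k => [|k IHk kn]; first by rewrite mul0r.
  have [s sP] := IHk (ltnW kn).
  have k01 i : (i <= n.+1)%N -> 0 <= (i%:R / n.+1%:R : R) <= 1.
    by move=> ni; rewrite divr_ge0//= ler_pdivrMr// mul1r ler_nat.
  set t' := (k.+1%:R / n.+1%:R : R); pose t := (k%:R / n.+1%:R : R).
  exists (fun x => s x * half_plane_sqrt (H (x, t') / H (x, t))) => x Xx.
  have [cs s2] := sP x Xx.
  have t01 : 0 <= t <= 1 by apply: k01; exact: ltnW.
  have t'01 : 0 <= t' <= 1 by exact: k01.
  have Hn0 : H (x, t) != 0 by apply/eqP; exact: H0.
  have pos : 0 < Re (H (x, t') / H (x, t)).
    have tt' : `|t' - t| < d.
      rewrite /t /t' -mulrBl -natrB ?leqnSn// subSnn mul1r ger0_norm //.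
    have := dH x t' t Xx t'01 t01 tt'.
    move: (H (x, t') / H (x, t)) => w.
    move=> /(le_lt_trans (Re_le _)); case: w => a b /=.
    by rewrite ltr_norml; lra.
  split; last by rewrite exprMn s2 half_plane_sqrtK// mulrCA divff// mulr1.
  have cHt r : 0 <= r <= 1 -> (fun x => H (x, r)) @ x --> H (x, r).
    move=> r01; apply: cvg_comp; last exact: (cH x r Xx r01).
    move=> A [[U V] /= [Ux Vr] UVA]; apply: filterS Ux => y Uy.
    by apply: UVA; split => //=; exact: nbhs_singleton.
  apply: (cvg_planeM cs); apply: (cvg_half_plane_sqrt pos).
  apply: (cvg_planeM (cHt _ t'01)).
  exact: (cvg_planeV Hn0 (cHt _ t01)).
by have := step n.+1 (leqnn _); rewrite divff.
Qed.

End SquareRoots.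

(** * Angles and polar coordinates *)

Section Circle.
Variable R : realType.
Local Notation C := (plane R).
Local Notation normc := (@ComplexField.Normc.normc R).
Local Notation Re := (@complex.Re R).
Local Notation Im := (@complex.Im R).
Implicit Types (z w : C) (x y : R).

Lemma expi2piD x y : expi2pi (x + y) = expi2pi x * expi2pi y :> C.
Proof.
rewrite /expi2pi mulrDr cosD sinD; apply/eqP; rewrite eq_complex /=.
by rewrite eqxx /= [X in _ == X]addrC eqxx.
Qed.

Lemma expi2pi0 : expi2pi 0 = 1 :> C.
Proof. by rewrite /expi2pi mulr0 cos0 sin0. Qed.

Lemma expi2pi_half : expi2pi 2^-1 = -1 :> C.
Proof.
rewrite /expi2pi mulrAC divff// mul1r cospi sinpi.
by apply/eqP; rewrite eq_complex /= oppr0 !eqxx.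
Qed.

Lemma expi2pi1 : expi2pi 1 = 1 :> C.
Proof. by rewrite (splitr 1) expi2piD !mul1r expi2pi_half mulrNN mulr1. Qed.

Lemma normc_expi2pi x : normc (expi2pi x) = 1.
Proof. by rewrite /= cos2Dsin2 sqrtr1. Qed.

Lemma expi2pi_neq0 x : expi2pi x != 0 :> C.
Proof. by rewrite -normc_gt0 normc_expi2pi. Qed.

Lemma expi2piN x : expi2pi (- x) = (expi2pi x)^-1 :> C.
Proof.
apply: (mulfI (expi2pi_neq0 x)).
by rewrite -expi2piD subrr expi2pi0 divff ?expi2pi_neq0.
Qed.

Lemma expi2pi_int x : x \is a Num.int -> expi2pi x = 1 :> C.
Proof.
have nat_case n : expi2pi n%:R = 1 :> C.
  elim: n => [|n IH]; first exact: expi2pi0.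
  by rewrite -addn1 natrD expi2piD IH expi2pi1 mulr1.
move/intrP => [[n ->|n ->]]; first by rewrite -pmulrn nat_case.
by rewrite NegzE mulrNz expi2piN -pmulrn nat_case invr1.
Qed.

(** After removal of the integer part, 2 pi x lies in [0, 2 pi), where cos takes
    the value 1 only at 0. *)
Lemma expi2pi_eq1 x : expi2pi x = 1 :> C -> x \is a Num.int.
Proof.
move=> Ex; set d := x - (Num.floor x)%:~R.
have dE : expi2pi d = 1 :> C.
  by rewrite expi2piD expi2piN Ex mul1r expi2pi_int ?invr1// intr_int.
have pi0 := pi_gt0 R.
have d0 : 0 <= d by rewrite subr_ge0 floor_le_tmp.
have d1 : d < 1 by rewrite ltrBlDl -intrD1 floorD1_gt.
suff d00 : d = 0 by move/eqP: d00; rewrite subr_eq0 => /eqP ->; exact: intr_int.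
move: dE => [cd _].
have [dh|dh] := lerP d 2^-1.
  have : 2 * pi * d = 0 :> R.
    by apply: cos_inj; rewrite ?in_itv /= ?cos0//; nra.
  by move/eqP; rewrite mulf_eq0 => /orP[|/eqP//]; nra.
have : 2 * pi * (1 - d) = 0 :> R.
  apply: cos_inj; rewrite ?in_itv /= ?cos0; [nra|nra|].
  have -> : 2 * pi * (1 - d) = - (2 * pi * d) + pi *+ 2 by rewrite -mulr_natl; ring.
  by rewrite cosD2pi cosN cd.
nra.
Qed.

Lemma expi2pi_inj x y : expi2pi x = expi2pi y :> C -> x - y \is a Num.int.
Proof.
move=> xy; apply: expi2pi_eq1.
by rewrite expi2piD expi2piN xy divff// expi2pi_neq0.
Qed.

Lemma expi2pi_surj w : normc w = 1 -> exists2 y, 0 <= y <= 1 & w = expi2pi y.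
Proof.
have pi0 := pi_gt0 R.
case: w => a b /= /(congr1 (fun x => x ^+ 2)).
rewrite expr1n sqr_sqrtr ?addr_ge0 ?sqr_ge0// => ab.
have a1 : -1 <= a <= 1 by nra.
have a0 := acos_ge0 a1; have api := acos_lepi a1.
have sE : Num.sqrt (1 - a ^+ 2) = `|b| by rewrite -ab addrAC subrr add0r sqrtr_sqr.
have yE (t : R) : 2 * pi * (t / (2 * pi)) = t by field; nra.
have [b0|b0] := lerP 0 b.
  exists (acos a / (2 * pi)).
    by rewrite divr_ge0 ?ler_pdivrMr//=; nra.
  by rewrite /expi2pi yE acosK// sin_acos// sE ger0_norm.
exists (- (acos a / (2 * pi)) + 1).
  have q0 : 0 <= acos a / (2 * pi) by rewrite divr_ge0//; nra.
  have q1 : acos a / (2 * pi) <= 1 by rewrite ler_pdivrMr; nra.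
  by lra.
rewrite expi2piD expi2pi1 mulr1 /expi2pi mulrN yE cosN sinN acosK// sin_acos// sE.
by rewrite ltr0_norm// opprK.
Qed.

Lemma expi2pi_continuous : continuous (@expi2pi R).
Proof.
move=> x; have c : (fun y : R => 2 * pi * y) @ x --> 2 * pi * x.
  by apply: cvgM; [exact: cvg_cst | exact: cvg_id].
apply: cvg_complex; apply: cvg_comp c _.
  exact: continuous_cos.
exact: continuous_sin.
Qed.

Lemma angle_repr (theta : angle R) : exists x : R, \pi_(angle R) x = theta.
Proof. by exists (repr theta); exact: reprK. Qed.

Lemma pi_angleP (x y : R) :
  \pi_(angle R) x = \pi_(angle R) y <-> x - y \is a Num.int.
Proof. by split => [/eqmodP|xy]; [|apply/eqmodP]. Qed.

Lemma normc_polar (r x : R) : 0 <= r -> normc (r%:C%C * expi2pi x) = r.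
Proof. by move=> r0; rewrite normc_mul normc_real normc_expi2pi mulr1 ger0_norm. Qed.

Lemma polar_inj (r s x y : R) : 0 < r -> 0 < s ->
  r%:C%C * expi2pi x = s%:C%C * expi2pi y :> C -> x - y \is a Num.int.
Proof.
move=> r0 s0 h; have rs : r = s.
  by rewrite -(normc_polar x (ltW r0)) h normc_polar// ltW.
apply: expi2pi_inj; move: h; rewrite rs; apply: mulfI.
by rewrite -normc_gt0 normc_real gtr0_norm.
Qed.

End Circle.

(** * Invariance of domain in the plane *)

Section InvarianceOfDomain.
Variable R : realType.
Local Notation C := (plane R).
Local Notation normc := (@ComplexField.Normc.normc R).
Local Notation Re := (@complex.Re R).
Local Notation Im := (@complex.Im R).
Implicit Types (z w : C).

Let circle : set C := [set z : C | normc z = 1].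

Lemma circle_compact : compact circle.
Proof.
apply: (@compact_plane _ _ 1) => [|z -> //].
rewrite (_ : circle = (normc : C -> R) @^-1` [set 1]) //.
apply: closed_comp; last exact: closed_eq.
by move=> z _; exact: normc_continuous.
Qed.

(** If s is a square root of g, then s (- z) / s z squares to -1, so along the
    circle it is constantly i or constantly -i.  But replacing z by - z turns
    this quotient into its inverse, and i and -i are not their own inverses. *)
Lemma odd_no_sqrt (g : C -> C) :
  (forall z, normc z = 1 -> g z <> 0) ->
  (forall z, normc z = 1 -> g (- z) = - g z) -> ~ has_sqrt circle g.
Proof.
move=> g0 gN [s sP].
have E1 u : circle (expi2pi u) by exact: normc_expi2pi.
have En1 u : circle (- expi2pi u) by apply: etrans (normc_opp _) _; exact: E1.
have sn0 z : circle z -> s z != 0.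
  move=> z1; apply/eqP => sz0; apply: (g0 z z1).
  by have [_ <-] := sP z z1; rewrite sz0 expr0n.
pose q (u : R) : C := s (- expi2pi u) / s (expi2pi u).
have cE (u : R) : expi2pi x @[x --> nbhs u] --> (expi2pi u : C).
  exact: expi2pi_continuous.
have cq (u : R) : q x @[x --> nbhs u] --> q u.
  have h1 := cvg_plane_comp (sP _ (E1 u)).1 (cE u).
  have h2 := cvg_plane_comp (sP _ (En1 u)).1 (cvg_planeN (cE u)).
  exact: (cvg_planeM (h2 _) (cvg_planeV (sn0 _ (E1 u)) h1)).
have q2 u : q u ^+ 2 = -1.
  rewrite exprMn exprVn (sP _ (En1 u)).2 (sP _ (E1 u)).2 gN; last exact: E1.
  by rewrite mulNr divff//; apply/eqP; exact: g0 (E1 u).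
have Imq u : Re (q u) = 0 /\ Im (q u) ^+ 2 = 1.
  have := q2 u; case: (q u) => a b; rewrite expr2 => -[/= h1 h2].
  have [->|a0] := eqVneq a 0; first by split=> //; nra.
  have b0 : b = 0 by apply: (mulfI a0); lra.
  by exfalso; move: h1; rewrite b0; nra.
have qq : q 0 * q 2^-1 = 1.
  rewrite /q expi2pi_half -expi2pi0 opprK mulrA.
  rewrite divfK; last exact: sn0 (E1 0).
  by rewrite (divff (sn0 _ (En1 0))) expi2pi0.
have Im01 : Im (q 2^-1) = - Im (q 0).
  move: qq (Imq 0) (Imq 2^-1).
  case: (q 0) (q 2^-1) => a b [c d] [/= h1 _] [/= a0 b1] [/= c0 d1]; nra.
have [|||x _ x0] := @IVT R (fun u => Im (q u)) 0 2^-1 0.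
- by rewrite invr_ge0.
- by apply: continuous_subspaceT => u; apply: cvg_Im; exact: cq.
- rewrite Im01; have [i0|i0] := lerP 0 (Im (q 0)).
    by rewrite ge_min le_max; apply/andP; split; apply/orP; [right|left]; lra.
  by rewrite ge_min le_max; apply/andP; split; apply/orP; [left|right]; lra.
by have := (Imq x).2; rewrite x0 expr0n /=; lra.
Qed.

(** Invariance of domain in the plane.  If the image of a disc of radius r
    about c missed a point y near f c, then f - y, hence also f - f c, would
    have a continuous square root on the circle of radius r.  The homotopy
    f (c + r x) - f (c - t r x), which avoids 0 by injectivity, would then give
    a square root of an odd map. *)
Lemma open_injective (f : C -> C) (U : set C) c : nbhs c U ->
  (forall z, U z -> {for z, continuous f}) ->
  (forall z w, U z -> U w -> f z = f w -> z = w) ->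
  nbhs (f c) (f @` U).
Proof.
move=> /nbhs_plane[e e0 eU] cf fI.
pose r : R := e / 2.
have r0 : 0 < r by rewrite /r; lra.
have Ur x (t : R) : circle x -> -1 <= t <= 1 -> U (c + (t * r)%:C%C * x).
  move=> x1 t1; apply: eU.
  rewrite opprD addrA subrr add0r normc_opp normc_mul normc_real x1 mulr1.
  have : `|t| <= 1 by rewrite ler_norml.
  by rewrite normrM (gtr0_norm r0) /r; nra.
pose G (a : R) (p : C * R) : C := f (c + (a * p.2 * r)%:C%C * p.1).
pose G1 (a : R) (p : C * R) : C := f (c + (a * r)%:C%C * p.1).
have cG a x (t : R) : circle x -> -1 <= a * t <= 1 ->
    (G a p @[p --> nbhs (x, t)]) --> G a (x, t).
  move=> x1 t1; apply: (cvg_plane_comp (cf _ (Ur x _ x1 t1))).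
  apply: cvg_planeD; first exact: cvg_cst.
  apply: cvg_planeM; last exact: cvg_fst.
  apply: cvg_real_complex; apply: cvgM; last exact: cvg_cst.
  by apply: cvgM; [exact: cvg_cst | exact: cvg_snd].
have cG1 a x (t : R) : circle x -> -1 <= a <= 1 ->
    (G1 a p @[p --> nbhs (x, t)]) --> G1 a (x, t).
  move=> x1 t1; apply: (cvg_plane_comp (cf _ (Ur x _ x1 t1))).
  apply: cvg_planeD; first exact: cvg_cst.
  by apply: cvg_planeM; [exact: cvg_cst | exact: cvg_fst].
have fne x (a b : R) : circle x -> -1 <= a <= 1 -> -1 <= b <= 1 -> a != b ->
    f (c + (a * r)%:C%C * x) <> f (c + (b * r)%:C%C * x).
  move=> x1 a1 b1 ab /(fI _ _ (Ur x a x1 a1) (Ur x b x1 b1)).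
  have x0 : x != 0 by rewrite -normc_gt0 x1.
  move/addrI/(mulIf x0)/complexI/mulIf => /(_ (lt0r_neq0 r0)) E.
  by rewrite E eqxx in ab.
have I1 : -1 <= (1 : R) <= 1 by lra.
have IN1 : -1 <= (-1 : R) <= 1 by lra.
have I0 : -1 <= (0 : R) <= 1 by lra.
have [m m0 mP] : exists2 m : R, 0 < m &
    forall x, circle x -> m <= normc (f (c + (1 * r)%:C%C * x) - f c).
  have [||| x0 x0P x0min] := @compact_EVT_min _ R
    (fun x : C => normc (f (c + (1 * r)%:C%C * x) - f c)) circle.
  - by exists 1; rewrite /circle /= expr0n /= addr0 expr1n sqrtr1.
  - exact: circle_compact.
  - apply: continuous_in_subspaceT => x; rewrite inE => x1.
    apply: continuous_at_filter => F FF Fx.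
    apply: cvg_normc; apply: cvg_planeB; last exact: cvg_cst.
    apply: (cvg_plane_comp (cf _ (Ur x _ x1 I1))).
    apply: cvg_planeD; first exact: cvg_cst.
    by apply: cvg_planeM; [exact: cvg_cst | exact: Fx].
  rewrite inE in x0P.
  exists (normc (f (c + (1 * r)%:C%C * x0) - f c)); last first.
    by move=> x x1; apply: x0min; rewrite inE.
  rewrite normc_gt0 subr_eq0; apply/eqP.
  have -> : f c = f (c + (0 * r)%:C%C * x0) by rewrite !mul0r addr0.
  by apply: fne => //; exact: oner_neq0.
apply/nbhs_plane; exists m => // y ym; apply: contrapT => yU.
have Uy x (t : R) : circle x -> -1 <= t <= 1 -> f (c + (t * r)%:C%C * x) <> y.
  by move=> x1 t1 xy; apply: yU; exists (c + (t * r)%:C%C * x) => //; exact: Ur.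
have I01 (t : R) : 0 <= t <= 1 -> -1 <= t <= 1 by lra.
(* f - y has a square root on the circle: contract the circle to its centre. *)
have s1 : has_sqrt circle (fun x => f (c + (1 * r)%:C%C * x) - y).
  pose H (p : C * R) : C := G 1 p - y.
  have -> : (fun x => f (c + (1 * r)%:C%C * x) - y) = (fun x => H (x, 1)).
    by apply/funext => x; rewrite /H /G /= !mul1r.
  apply: (has_sqrt_homotopy circle_compact).
  - move=> x t x1 t01; apply: cvg_planeB; last exact: cvg_cst.
    by apply: cG => //; rewrite mul1r; exact: I01.
  - by move=> x t x1 t01 /eqP; rewrite /H /G /= subr_eq0 mul1r => /eqP; apply: Uy; auto.
  exists (fun=> sqrtc (f c - y)) => x x1; split.
    by apply: continuous_at_filter => F FF _; exact: cvg_cst.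
  by rewrite sqr_sqrtc /H /G /= mulr0 !mul0r addr0.
(* Move y to f c along a segment; its points are at distance less than m from
   f c, so it misses the image of the circle. *)
have s2 : has_sqrt circle (fun x => f (c + (1 * r)%:C%C * x) - f c).
  pose H (p : C * R) : C := G1 1 p - (y + p.2%:C%C * (f c - y)).
  have -> : (fun x => f (c + (1 * r)%:C%C * x) - f c) = (fun x => H (x, 1)).
    by apply/funext => x; rewrite /H /G1 /= rmorph1 !mul1r [y + _]addrC subrK.
  apply: (has_sqrt_homotopy circle_compact).
  - move=> x t x1 t01; apply: cvg_planeB; first exact: cG1.
    apply: cvg_planeD; first exact: cvg_cst.
    by apply: cvg_planeM; [apply: cvg_real_complex; exact: cvg_snd|exact: cvg_cst].
  - move=> x t x1 t01 /eqP; rewrite /H /G1 /= subr_eq0 => /eqP h.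
    have := mP x x1; rewrite h.
    have -> : y + t%:C%C * (f c - y) - f c = (t - 1)%:C%C * (f c - y) :> C.
      by rewrite rmorphB rmorph1 mulrBl mul1r opprB addrA addrAC addrC addrA.
    rewrite normc_mul normc_real => mt.
    have : `|t - 1| <= 1 by rewrite ler_norml; lra.
    by have := normc_ge0 (f c - y); nra.
  case: s1 => s sP; exists s => x x1; have [cs s2] := sP x x1; split=> //.
  by rewrite s2 /H /G1 /= mul0r addr0.
(* Let the point subtracted from f (c + r x) run from f c to f (c - r x). *)
apply: (@odd_no_sqrt (fun x => f (c + (1 * r)%:C%C * x) - f (c + (-1 * r)%:C%C * x))).
- move=> x x1 /eqP; rewrite subr_eq0 => /eqP; apply: fne => //.
  by rewrite -subr_eq0 opprK; apply: lt0r_neq0; lra.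
- move=> x x1; rewrite opprB !mulN1r rmorphN /= !mulNr !mul1r.
  by rewrite !mulrN opprK.
pose H (p : C * R) : C := G1 1 p - G (-1) p.
have -> : (fun x => f (c + (1 * r)%:C%C * x) - f (c + (-1 * r)%:C%C * x))
    = (fun x => H (x, 1)).
  by apply/funext => x; rewrite /H /G1 /G /= mulr1.
apply: (has_sqrt_homotopy circle_compact).
- move=> x t x1 t01; apply: cvg_planeB; first exact: cG1.
  by apply: cG => //; lra.
- move=> x t x1 t01 /eqP; rewrite /H /G1 /G /= subr_eq0 => /eqP.
  apply: fne => //; first lra.
  by rewrite -subr_eq0; apply: lt0r_neq0; lra.
case: s2 => s sP; exists s => x x1; have [cs s2] := sP x x1; split=> //.
by rewrite s2 /H /G1 /G /= mulr0 !mul0r addr0.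
Qed.

End InvarianceOfDomain.

(** * Connected sets *)

Section Connectedness.

Lemma connected_between (T : topologicalType) (A B : set T) :
  connected A -> A `<=` B -> B `<=` closure A -> connected B.
Proof.
move=> cA AB BA U [u Uu] [C1 oC1 U1] [C2 cC2 U2].
have [w [Aw C1w]] : A `&` C1 !=set0.
  move: Uu; rewrite U1 => -[Bu C1u].
  by apply: (BA u Bu); exact: open_nbhs_nbhs.
have AU : A `&` U = A.
  apply: cA.
  - by exists w; split => //; rewrite U1; split => //; exact: AB.
  - by exists C1 => //; rewrite U1 setIA (setIidl AB).
  - by exists C2 => //; rewrite U2 setIA (setIidl AB).
rewrite U2; apply: setIidl => z /BA zA; apply: cC2; apply: closure_subset zA => v.
by rewrite -AU => -[_]; rewrite U2 => -[].
Qed.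

Lemma connected_setX (T U : topologicalType) (A : set T) (B : set U) a :
  A a -> connected A -> connected B -> connected (A `*` B).
Proof.
move=> Aa cA cB.
have hor b : connected [set (x, b) | x in A].
  apply: connected_continuous_connected => //; apply: continuous_subspaceT.
  move=> x V [[V1 V2] /= [V1x V2b] sub]; apply: filterS V1x => y V1y.
  by apply: sub; split => //=; exact: nbhs_singleton.
have ver : connected [set (a, y) | y in B].
  apply: connected_continuous_connected => //; apply: continuous_subspaceT.
  move=> x V [[V1 V2] /= [V1x V2b] sub]; apply: filterS V2b => y V1y.
  by apply: sub; split => //=; exact: nbhs_singleton.
have [B0|[b0 Bb0]] : B = set0 \/ B !=set0.
- by have [->|/set0P] := eqVneq B set0; [left | right].
- by rewrite B0 setX0; exact: connected0.
rewrite (_ : A `*` B = \bigcup_(b in B)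
    ([set (x, b) | x in A] `|` [set (a, y) | y in B])); last first.
  apply/seteqP; split => [[x y] /= [Ax By]|[x y] [b Bb]].
    by exists y => //; left; exists x.
  by case=> [[x' Ax' [<- <-]]|[y' By' [<- <-]]].
apply: bigcup_connected.
  by exists (a, b0) => b Bb; right; exists b0.
move=> b Bb; apply: connectedU => //.
by exists (a, b); split; [exists a | exists b].
Qed.

Variable R : realType.
Local Notation C := (plane R).
Local Notation normc := (@ComplexField.Normc.normc R).

(** Otherwise two disjoint open sets would separate the intersection and, by
    compactness, already one of the members of the family. *)
Lemma connected_bigcap_nested (A : R -> set C) (M : R) :
  (forall e, 0 < e -> closed (A e)) -> (forall e, 0 < e -> connected (A e)) ->
  (forall d e, 0 < d -> d <= e -> A d `<=` A e) ->
  (forall z, A 1 z -> normc z <= M) ->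
  connected (\bigcap_(e in [set e : R | 0 < e]) A e).
Proof.
move=> clA coA mono bdA; apply/connectedP => E [E0 IE [sep1 sep2]].
set I := \bigcap_(e in _) _ in IE.
have clI : closed I by apply: closed_bigI => e; exact: clA.
have clE b : closed (E b).
  move=> z Ez; have : I z.
    by apply: clI; apply: closure_subset Ez; rewrite IE; case: b => w Ew; [right|left].
  rewrite IE => -[]; case: b Ez => // Ez Ew.
  - by have : set0 z by rewrite -sep2; split.
  - by have : set0 z by rewrite -sep1; split.
have EI b z : E b z -> I z by rewrite IE; case: b; [right | left].
have IM z : I z -> normc z <= M by move=> Iz; apply: bdA; apply: Iz => /=.
have [B /set_nbhsP[D [oD ED DB]] clB] : exists2 B, set_nbhs (E false) B &
    closure B `<=` ~` E true.
  apply: (compact_normal_local (@plane_hausdorff R) (@compact_disc R (M + 1))).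
  - move=> z Ez; apply/nbhs_plane; exists 1 => // w zw /=.
    have := normc_add (w - z) z; rewrite subrK normc_sub.
    by have := IM z (EI _ _ Ez); lra.
  - exact: clE.
  - apply/set_nbhsP; exists (~` E true); split => //; first by rewrite openC; exact: clE.
    by move=> z Ef Et; have : set0 z by rewrite -sep1; split => //; exact: subset_closure.
pose G := ~` closure B.
have oG : open G by rewrite openC; exact: closed_closure.
have EG : E true `<=` G by move=> z Ez Bz; exact: clB Bz Ez.
have DG : D `&` G = set0.
  by rewrite -subset0 => z [Dz]; apply; apply: subset_closure; exact: DB.
have cF : compact (A 1 `&` ~` (D `|` G)).
  apply: (@compact_plane _ _ M); last by move=> z [/bdA].
  by apply: closedI; [exact: clA | rewrite closedC; exact: openU].
have [e [e0 e1 eP]] : exists e : R, [/\ 0 < e, e < 1 &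
    (A 1 `&` ~` (D `|` G)) `<=` ~` A e].
  have : \forall e \near (0 : R)^'+, (A 1 `&` ~` (D `|` G)) `<=` ~` A e.
    move/compact_near_coveringP: cF; apply => z [A1z nDG].
    have : ~ I z.
      by rewrite IE => -[Ez|Ez]; apply: nDG; [left; exact: ED|right; exact: EG].
    move=> /existsNP[d /not_implyP[/= d0 nAz]].
    exists (~` A d, [set e | 0 < e < d]).
      split => /=.
        by apply: open_nbhs_nbhs; split => //; rewrite openC; exact: clA.
      by near=> e; apply/andP; split; near: e; [exact: nbhs_right_gt|exact: nbhs_right_lt].
    by move=> [w e] /= [nAw /andP[e0 ed]] Aw; apply: nAw; apply: mono Aw => //; exact: ltW.
  move=> near_e.
  have [e [[e0 e1] eP]] : exists e, ([set e : R | 0 < e] `&` [set e | e < 1] `&`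
      (fun e => (A 1 `&` ~` (D `|` G)) `<=` ~` A e)) e.
    apply: (@filter_ex _ (0 : R)^'+); apply: filterI near_e.
    by apply: filterI; [exact: nbhs_right_gt | exact: nbhs_right_lt].
  by exists e.
have sepDG : separated D G.
  split; rewrite -subset0 => z [].
    move=> /(_ G) h Gz; have [] := h (open_nbhs_nbhs (conj oG Gz)).
    by move=> w wDG; have : set0 w by rewrite -DG.
  move=> Dz /(_ D) h; have [] := h (open_nbhs_nbhs (conj oD Dz)).
  by move=> w [Gw Dw]; have : set0 w by rewrite -DG.
have AeDG : A e `<=` D `|` G.
  move=> z Az; apply: contrapT => nz; apply: (eP z) => //; split => //.
  by apply: mono Az => //; exact: ltW.
have EA b z : E b z -> A e z by move=> /EI; apply.
have [w0 Ew0] := E0 false; have [w1 Ew1] := E0 true.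
case: (connected_subset sepDG AeDG (coA e e0)) => h.
  by have : set0 w1 by rewrite -DG; split; [apply: h; exact: EA Ew1 | exact: EG].
by have : set0 w0 by rewrite -DG; split; [exact: ED | apply: h; exact: EA Ew0].
Unshelve. all: by end_near. Qed.

End Connectedness.

(** * Homeomorphisms and arcs of the plane *)

Section PlaneArcs.
Variable R : realType.
Local Notation C := (plane R).
Local Notation normc := (@ComplexField.Normc.normc R).
Local Notation Im := (@complex.Im R).
Implicit Types (x y z w : C).

Lemma continuous_inverse (h k : C -> C) :
  continuous h -> cancel h k -> cancel k h -> continuous k.
Proof.
move=> ch hk kh w A kA.
have : nbhs (h (k w)) (h @` A).
  by apply: open_injective kA _ _ => [z _|z1 z2 _ _]; [exact: ch | exact: can_inj hk z1 z2].
by rewrite kh; apply: filterS => _ [z Az <-] /=; rewrite hk.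
Qed.

(** Add to x the vector z - y, weighted by a tent function of x that is 1 at y
    and 0 outside the disc of radius r.  The weight has Lipschitz constant 1 / r
    and |z - y| < r, so the map is injective; on each line parallel to z - y it
    is onto by the intermediate value theorem. *)
Lemma push_homeomorphism y z (r : R) : normc (z - y) < r ->
  exists h k : C -> C, [/\ continuous h, continuous k, cancel h k, cancel k h &
    h y = z /\ forall x, r <= normc (x - y) -> h x = x].
Proof.
move=> zy; have r0 : 0 < r by have := normc_ge0 (z - y); lra.
pose bump x : R := Num.max 0 (1 - normc (x - y) / r).
have bump01 x : 0 <= bump x <= 1.
  rewrite /bump le_max lexx ge_max ler01 /= gerBl.
  by rewrite divr_ge0 ?normc_ge0// ltW.
have bump_lip x1 x2 : `|bump x2 - bump x1| <= normc (x1 - x2) / r.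
  have n1 : normc (x1 - y) / r - normc (x2 - y) / r <= normc (x1 - x2) / r.
    rewrite -mulrBl ler_pM2r ?invr_gt0//.
    by have := normc_add (x1 - x2) (x2 - y); rewrite subrKA; lra.
  have n2 : normc (x2 - y) / r - normc (x1 - y) / r <= normc (x1 - x2) / r.
    rewrite -mulrBl ler_pM2r ?invr_gt0//.
    by have := normc_add (x2 - x1) (x1 - y); rewrite subrKA (normc_sub x2); lra.
  have n3 : 0 <= normc (x1 - x2) / r by rewrite divr_ge0 ?normc_ge0// ltW.
  rewrite /bump ler_norml.
  move: (normc (x1 - y) / r) (normc (x2 - y) / r) (normc (x1 - x2) / r) n1 n2 n3.
  by move=> a b c n1 n2 n3; case: (lerP 0 (1 - b)); case: (lerP 0 (1 - a)); lra.
have cvg_bump (T : Type) (F : set_system T) (FF : Filter F) (f : T -> C) x :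
    f @ F --> x -> (fun t => bump (f t)) @ F --> bump x.
  move=> fx; apply: real_cvg => e e0; have er : 0 < e * r by exact: mulr_gt0.
  apply: filterS (cvg_planeP fx er) => t xt.
  apply: le_lt_trans (bump_lip (f t) x) _.
  by rewrite ltr_pdivrMr// normc_sub.
pose h x : C := x + (bump x)%:C%C * (z - y).
have ch : continuous h.
  move=> x; apply: continuous_at_filter => F FF Fx.
  apply: (cvg_planeD Fx); apply: cvg_planeM; last exact: cvg_cst.
  by apply: cvg_real_complex; exact: cvg_bump.
have hI : injective h.
  move=> x1 x2 h12.
  have E : x1 - x2 = (bump x2 - bump x1)%:C%C * (z - y).
    rewrite rmorphB mulrBl; apply/eqP; rewrite subr_eq addrAC -subr_eq opprK.
    by rewrite [eqbRHS]addrC; apply/eqP; exact: h12.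
  apply/eqP; rewrite -subr_eq0; apply: contraT => x12.
  have p0 : 0 < normc (x1 - x2) by rewrite normc_gt0.
  have := bump_lip x1 x2; rewrite ler_pdivlMr// => L.
  have : normc (x1 - x2) = `|bump x2 - bump x1| * normc (z - y).
    by rewrite {1}E normc_mul normc_real.
  have b0 : 0 < `|bump x2 - bump x1|.
    rewrite normr_gt0; apply: contraTneq x12 => b0.
    by rewrite E b0 mul0r eqxx.
  nra.
have hS w : exists x, h x = w.
  pose f (s : R) : R := s - bump (w - s%:C%C * (z - y)).
  have [|||s _ fs] := @IVT R f 0 1 0 => //.
  - apply: continuous_subspaceT => s; apply: continuous_at_filter => F FF Fs.
    apply: cvgB => //; apply: cvg_bump; apply: cvg_planeB; first exact: cvg_cst.
    by apply: cvg_planeM; [exact: cvg_real_complex | exact: cvg_cst].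
  - have f0 : f 0 <= 0.
      by rewrite /f sub0r oppr_le0; have /andP[] := bump01 (w - 0%:C%C * (z - y)).
    have f1 : 0 <= f 1.
      by rewrite /f subr_ge0; have /andP[] := bump01 (w - 1%:C%C * (z - y)).
    by rewrite ge_min le_max f0 f1 orbT.
  exists (w - s%:C%C * (z - y)); rewrite /h.
  move/eqP: fs; rewrite subr_eq0 => /eqP <-.
  by rewrite subrK.
have [k kh] := choice hS.
have hk : cancel h k by move=> x; apply: hI; exact: kh.
exists h, k; split;
  [exact: ch | exact: continuous_inverse ch hk kh | exact: hk | exact: kh | split].
  rewrite /h /bump subrr normc0 mul0r subr0.
  by rewrite (max_r ler01) rmorph1 mul1r addrC subrK.
move=> x rx; rewrite /h /bump max_l ?rmorph0 ?mul0r ?addr0//.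
by rewrite subr_le0 ler_pdivlMr// mul1r.
Qed.

(** On an open set contained in the arc, the parameter of the arc would be a
    continuous injection of a plane open set into the real line, contrary to
    invariance of domain. *)
Lemma arc_complement_dense (c : R -> C) :
  {within `[0, 1], continuous c} -> {in `[0, 1] &, injective c} ->
  forall z (V : set C), nbhs z V -> exists2 y, V y & ~ (c @` `[0, 1]) y.
Proof.
move=> cc cI z V zV; apply: contrapT => Vc.
have {}Vc y : V y -> exists t : R, 0 <= t <= 1 /\ c t = y.
  move=> Vy; apply: contrapT => nt; apply: Vc; exists y => // -[t t01 ty].
  by apply: nt; exists t; move: t01; rewrite /= in_itv.
have Vc' y : exists t : R, V y -> 0 <= t <= 1 /\ c t = y.
  have [Vy|nVy] := pselect (V y); last by exists 0 => /nVy.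
  by have [t tP] := Vc y Vy; exists t.
have [k kP] := choice Vc'.
pose U := interior V.
have UV y : U y -> V y by exact: interior_subset.
have zU : nbhs z U by exact: nbhs_interior.
have kc y : U y -> {for y, continuous (fun v => (k v)%:C%C : C)}.
  move=> Uy; suff kr : k v @[v --> nbhs y] --> k y by exact: cvg_real_complex kr.
  apply: (@real_cvg _ _ (nbhs y)) => e e0.
  have [k01 cky] := kP y (UV y Uy).
  (* Parameters at distance at least e from k y fill a compact part of the arc
     that misses y. *)
  pose T := [set t : R | 0 <= t <= 1] `&` [set t | e <= `|k y - t|].
  have T01 : T `<=` `[0, 1]%classic by move=> t [/= t01 _]; rewrite /= in_itv.
  have cT : compact T.
    apply: compact_closedI.
      have -> : [set t : R | 0 <= t <= 1] = `[0, 1]%classic.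
        by apply/seteqP; split => t; rewrite /= in_itv.
      exact: segment_compact.
    rewrite (_ : [set t | _] = (fun t => `|k y - t|) @^-1` [set x | e <= x]) //.
    apply: closed_comp; last exact: closed_ge.
    move=> t _; apply: cvg_norm; apply: cvgB; [exact: cvg_cst | exact: cvg_id].
  have clT : closed (c @` T).
    apply: compact_closed; first exact: plane_hausdorff.
    by apply: continuous_compact => //; exact: continuous_subspaceW T01 cc.
  have nT : nbhs y (~` (c @` T)).
    apply: open_nbhs_nbhs; split; first by rewrite openC.
    move=> [t [/= t01 te] ty]; move: te.
    have -> : t = k y by apply: cI; rewrite ?inE ?in_itv//= cky.
    by rewrite subrr normr0; lra.
  have nU : nbhs y U by exact: nbhs_interior.
  apply: filterS2 nT nU => v vT Uv; rewrite ltNge; apply/negP => ev.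
  have [kv01 ckv] := kP v (UV v Uv).
  by apply: vT; exists (k v).
have : nbhs ((k z)%:C%C : C) ((fun v => (k v)%:C%C : C) @` U).
  apply: open_injective zU kc _ => v1 v2 Uv1 Uv2 /complexI kk.
  by rewrite -(kP v1 (UV _ Uv1)).2 -(kP v2 (UV _ Uv2)).2 kk.
move=> /nbhs_plane[e e0 eP].
have [|v _ /(congr1 Im) /=] := eP ((k z) +i* (e / 2))%C.
  apply: le_lt_trans (normc_le _) _ => /=.
  by rewrite subrr normr0 add0r sub0r normrN gtr0_norm; lra.
by lra.
Qed.

End PlaneArcs.

(** * The Riemann map as a homeomorphism *)

Section RiemannMap.
Variable R : realType.
Local Notation C := (plane R).
Local Notation normc := (@ComplexField.Normc.normc R).
Variables (K : set C) (Phi : C -> C).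
Hypotheses (K_compact : compact K) (Phi_riemann : riemann_map K Phi).
Implicit Types (z w : C).

Lemma K_closed : closed K.
Proof. exact: compact_closed (@plane_hausdorff R) K_compact. Qed.

Lemma K_bounded : exists2 B : R, 0 < B & forall z, K z -> normc z <= B.
Proof.
have [->|/set0P K0] := eqVneq K set0; first by exists 1.
have [] := compact_EVT_max K0 K_compact (f := (normc : C -> R)).
  by apply: continuous_subspaceT; exact: normc_continuous.
move=> c _ cmax; exists (normc c + 1); first by have := normc_ge0 c; lra.
by move=> z Kz; have := cmax z (mem_set Kz); lra.
Qed.

Lemma Phi_continuous z : ~ K z -> {for z, continuous Phi}.
Proof.
case: Phi_riemann => dP _ _ _ /dP /derivable1_diffP.
exact: differentiable_continuous.
Qed.

Lemma Phi_gt1 z : ~ K z -> 1 < normc (Phi z).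
Proof.
case: Phi_riemann => _ [fP _ _] _ _ Kz.
by have := fP z Kz; rewrite /= normE -(rmorph1 (real_complex R)) ltcR.
Qed.

Lemma Phi_inj z w : ~ K z -> ~ K w -> Phi z = Phi w -> z = w.
Proof.
by case: Phi_riemann => _ [_ iP _] _ _ Kz Kw; apply: iP; rewrite inE.
Qed.

(** Continuity and injectivity suffice, by invariance of domain. *)
Lemma Phi_open z (U : set C) : ~ K z -> nbhs z U ->
  nbhs (Phi z) (Phi @` (U `&` ~` K)).
Proof.
move=> Kz zU; apply: open_injective.
- apply: filterI zU _; apply: open_nbhs_nbhs; split => //.
  by rewrite openC; exact: K_closed.
- by move=> w [_ Kw]; exact: Phi_continuous.
- by move=> w1 w2 [_ Kw1] [_ Kw2]; exact: Phi_inj.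
Qed.

Lemma Phi_surj w : 1 < normc w -> exists z, ~ K z /\ Phi z = w.
Proof.
case: Phi_riemann => _ [_ _ sP] _ _ w1.
have [|z Kz zw] := sP w; last by exists z.
by rewrite /= normE -(rmorph1 (real_complex R)) ltcR.
Qed.

Definition Psi w : C := xget 0 [set z | ~ K z /\ Phi z = w].

Lemma PsiP w : 1 < normc w -> ~ K (Psi w) /\ Phi (Psi w) = w.
Proof.
move=> /Phi_surj[z zP].
by apply: (@xgetPex _ 0 [set z | ~ K z /\ Phi z = w]); exists z.
Qed.

Lemma PhiK z : ~ K z -> Psi (Phi z) = z.
Proof. by move=> Kz; have [Kp] := PsiP (Phi_gt1 Kz); exact: Phi_inj. Qed.

Lemma Psi_continuous w : 1 < normc w -> {for w, continuous Psi}.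
Proof.
move=> w1 A; have [Kw PhiPsi] := PsiP w1.
move=> /(Phi_open Kw); rewrite PhiPsi; apply: filterS => _ [z [Az Kz] <-] /=.
by rewrite PhiK.
Qed.

Lemma at_infinity_continuous0 : {for 0, continuous (at_infinity Phi)}.
Proof.
case: Phi_riemann => _ _ /derivable1_diffP + _.
exact: differentiable_continuous.
Qed.

Lemma at_infinityV z : ~ K z -> z != 0 -> at_infinity Phi z^-1 = (Phi z)^-1.
Proof. by move=> Kz z0; rewrite /at_infinity invr_eq0 (negPf z0) invrK. Qed.

Lemma at_infinity0 : at_infinity Phi 0 = 0.
Proof. by rewrite /at_infinity eqxx. Qed.

Lemma Phi_infty (M : R) : 0 < M -> exists2 B : R, 0 < B &
  forall z, ~ K z -> B < normc z -> M < normc (Phi z).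
Proof.
move=> M0; have iM0 : 0 < M^-1 by rewrite invr_gt0.
have : nbhs (0 : C) [set u |
    normc (at_infinity Phi 0 - at_infinity Phi u) < M^-1].
  exact: (cvg_planeP at_infinity_continuous0 iM0).
move=> /nbhs_plane[e e0 eP].
exists e^-1; first by rewrite invr_gt0.
move=> z Kz ez.
have zp : 0 < normc z by apply: lt_trans ez; rewrite invr_gt0.
have := eP z^-1; rewrite sub0r normc_opp normcV invf_plt ?posrE// => /(_ ez).
rewrite /mkset (at_infinityV Kz) -?normc_gt0// at_infinity0 sub0r normc_opp normcV.
have := Phi_gt1 Kz => p1.
by rewrite ltf_pV2 ?posrE//; lra.
Qed.

(** Invariance of domain, applied at 0 to the Riemann map read in 1 / z, shows
    that every point of large modulus is the image of a point of large modulus;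
    by injectivity it is the image of no other point. *)
Lemma Psi_infty (B : R) : 0 < B -> exists2 M : R, 0 < M &
  forall z, ~ K z -> M < normc (Phi z) -> B < normc z.
Proof.
move=> B0; have [BK BK0 KB] := K_bounded.
pose U : set C := [set u | normc u < (B + BK)^-1].
have d0 : 0 < (B + BK)^-1 by rewrite invr_gt0; lra.
have Ularge u : U u -> u != 0 -> B + BK < normc u^-1.
  rewrite /U /= => Uu u0; rewrite normcV.
  by rewrite -[ltLHS]invrK ltf_pV2 ?posrE// normc_gt0.
have UK u : U u -> u != 0 -> ~ K u^-1.
  by move=> Uu u0 /KB; have := Ularge u Uu u0; lra.
have nU : nbhs (0 : C) U.
  by apply/nbhs_plane; exists (B + BK)^-1 => // w; rewrite sub0r normc_opp.
have : nbhs (at_infinity Phi 0) (at_infinity Phi @` U).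
  apply: open_injective nU _ _.
  - move=> u Uu; have [->|u0] := eqVneq u 0; first exact: at_infinity_continuous0.
    have eqn : \forall v \near u, (Phi v^-1)^-1 = at_infinity Phi v.
      have : \forall v \near u, v != 0.
        have u1 : 0 < normc u by rewrite normc_gt0.
        apply/nbhs_plane; exists (normc u) => // w; apply: contraPN => /eqP ->.
        by rewrite subr0 ltxx.
      by apply: filterS => v v0; rewrite /at_infinity (negPf v0).
    rewrite /prop_for /continuous_at /at_infinity (negPf u0).
    apply: cvg_trans (near_eq_cvg eqn) _.
    have iu : (fun v => v^-1) @ nbhs u --> (u^-1 : C).
      exact: (cvg_planeV u0 (@cvg_id _ (nbhs u))).
    have Pu : Phi u^-1 != 0.
      by rewrite -normc_gt0; have := Phi_gt1 (UK u Uu u0); lra.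
    exact: (cvg_planeV Pu (cvg_plane_comp (Phi_continuous (UK u Uu u0)) iu)).
  - move=> u v Uu Uv; rewrite /at_infinity.
    have nz w : U w -> w != 0 -> (Phi w^-1)^-1 != 0.
      by move=> Uw w0; rewrite invr_eq0 -normc_gt0; have := Phi_gt1 (UK w Uw w0); lra.
    have [u0|u0] := eqVneq u 0; have [v0|v0] := eqVneq v 0.
    + by rewrite u0 v0.
    + by move=> h; have := nz v Uv v0; rewrite -h eqxx.
    + by move=> h; have := nz u Uu u0; rewrite h eqxx.
    by move=> /invr_inj /(Phi_inj (UK u Uu u0) (UK v Uv v0)) /invr_inj.
rewrite at_infinity0 => /nbhs_plane[m m0 mP].
exists m^-1; first by rewrite invr_gt0.
move=> z Kz mz; have p1 := Phi_gt1 Kz.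
have [|u Uu uz] := mP (Phi z)^-1.
  rewrite sub0r normc_opp normcV invf_plt ?posrE//; lra.
have u0 : u != 0.
  apply/eqP => u0; move: uz; rewrite u0 /at_infinity eqxx => /esym /eqP.
  by rewrite invr_eq0; apply/negP; rewrite -normc_gt0; lra.
move: uz; rewrite /at_infinity (negPf u0) => /invr_inj.
move=> /(Phi_inj (UK u Uu u0) Kz) <-; have := Ularge u Uu u0; lra.
Qed.

(** For a suitable M, the points with 1 + e <= |Phi z| <= M form a compact set
    disjoint from K, and those with |Phi z| > M are far from K. *)
Lemma Phi_boundary p (e : R) : K p -> 0 < e ->
  \forall z \near p, ~ K z -> normc (Phi z) < 1 + e.
Proof.
move=> Kp e0; have [B B0 KB] := K_bounded.
have [M M0 MP] : exists2 M : R, 0 < M &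
  forall z, ~ K z -> M < normc (Phi z) -> B + 1 < normc z by apply: Psi_infty; lra.
pose A : set C := [set w | 1 + e <= normc w] `&` [set w | normc w <= M].
have cA : compact A.
  rewrite /A setIC; apply: compact_closedI; first exact: compact_disc.
  rewrite (_ : [set w | _] = (normc : C -> R) @^-1` [set x | 1 + e <= x]) //.
  by apply: closed_comp; [move=> z _; exact: normc_continuous | exact: closed_ge].
have clA : closed (Psi @` A).
  apply: compact_closed; first exact: plane_hausdorff.
  apply: continuous_compact => //; apply: continuous_in_subspaceT => w.
  by rewrite inE => -[/= w1 _]; apply: Psi_continuous; lra.
have nA : nbhs p (~` (Psi @` A)).
  apply: open_nbhs_nbhs; split; first by rewrite openC.
  by move=> [w [/= w1 _] wp]; have [] := @PsiP w; [lra | rewrite wp].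
have n1 : nbhs p [set z | normc (p - z) < 1] by apply/nbhs_plane; exists 1.
apply: filterS2 nA n1 => z zA /= pz Kz; rewrite ltNge; apply/negP => ez.
apply: zA; exists (Phi z); last exact: PhiK.
split => //=; rewrite leNgt; apply/negP => /(MP z Kz).
have := KB p Kp; have := normc_add (z - p) p; rewrite subrK normc_sub; lra.
Qed.

Lemma Phi_le2_bounded :
  exists B : R, forall z, ~ K z -> normc (Phi z) <= 2 -> normc z <= B.
Proof.
have [B B0 BP] := @Phi_infty 2 ltac:(by []).
by exists B => z Kz z2; rewrite leNgt; apply/negP => /(BP z Kz); lra.
Qed.

(** * Sectors and impressions *)

Definition sector (x e : R) : set C :=
  [set z | ~ K z /\ exists y r : R,
    [/\ `|y - x| < e, 1 < r < 1 + e & Phi z = r%:C%C * expi2pi y]].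

Lemma sector_sub x d e : d <= e -> sector x d `<=` sector x e.
Proof.
by move=> de z [Kz [y [r [yx r1 zE]]]]; split => //; exists y, r; split => //; lra.
Qed.

Lemma sector_norm x e z : sector x e z -> normc (Phi z) < 1 + e.
Proof. by move=> [_ [y [r [_ r1 ->]]]]; rewrite normc_polar; lra. Qed.

Lemma sector_connected x e : 0 < e -> connected (sector x e).
Proof.
move=> e0.
pose P : set (R * R) := `]x - e, x + e[%classic `*` `]1, 1 + e[%classic.
pose f (p : R * R) : C := Psi (p.2%:C%C * expi2pi p.1).
have -> : sector x e = f @` P.
  apply/seteqP; split => [z [Kz [y [r [yx r1 zE]]]]|_ [[y r] [/= + +] <-]].
    exists (y, r); last by rewrite /f /= -zE PhiK.
    by split; rewrite /= in_itv /=; move: yx; rewrite ltr_norml; lra.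
  rewrite !in_itv /= => yx r1.
  have [|h1 h2] := @PsiP (r%:C%C * expi2pi y); first by rewrite normc_polar; lra.
  by split => //; exists y, r; split => //; rewrite ltr_norml; lra.
apply: connected_continuous_connected.
  apply: (@connected_setX _ _ _ _ x); first by rewrite /= in_itv /=; lra.
    by apply/connected_intervalP; exact: interval_is_interval.
  by apply/connected_intervalP; exact: interval_is_interval.
apply: continuous_in_subspaceT => -[y r]; rewrite inE => -[_ /=].
rewrite in_itv /= => r1.
have h1 : 1 < normc (r%:C%C * expi2pi y) by rewrite normc_polar; lra.
apply: continuous_at_filter => F FF Fp.
apply: (cvg_plane_comp (Psi_continuous h1)).
apply: cvg_planeM.
  by apply: cvg_real_complex; exact: (cvg_comp _ _ Fp cvg_snd).
exact: (cvg_comp _ _ (cvg_comp _ _ Fp cvg_fst) (@expi2pi_continuous R y)).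
Qed.

(** The impression described by limits of the inverse Riemann map when angle and
    radius vary together.  In this form it is a nested intersection of connected
    sets. *)
Definition prime_impression (x : R) : set C :=
  \bigcap_(e in [set e : R | 0 < e]) closure (sector x e).

Lemma prime_impression_sub x : prime_impression x `<=` K.
Proof.
move=> z zI; apply: contrapT => Kz; have p1 := Phi_gt1 Kz.
have e0 : 0 < (normc (Phi z) - 1) / 2 by lra.
have : nbhs z [set w | normc (Phi z - Phi w) < (normc (Phi z) - 1) / 2].
  exact: (cvg_planeP (Phi_continuous Kz) e0).
move=> /(zI _ e0)[w [/sector_norm ws]]; rewrite /mkset => wz.
by have := normc_add (Phi z - Phi w) (Phi w); rewrite subrK; lra.
Qed.

Lemma prime_impression_boundary x : prime_impression x `<=` boundary K.
Proof.
move=> z zI; split; first by apply: subset_closure; exact: prime_impression_sub zI.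
by move=> /(zI 1 ltr01)[w [[Kw _] /Kw]].
Qed.

Lemma prime_impression_connected x : connected (prime_impression x).
Proof.
have [B BP] := Phi_le2_bounded.
apply: (@connected_bigcap_nested _ _ B).
- by move=> e _; exact: closed_closure.
- by move=> e e0; apply: connected_closure; exact: sector_connected.
- by move=> d e _ de; apply: closure_subset; exact: sector_sub.
move=> z zs; rewrite leNgt; apply/negP => Bz.
have d0 : 0 < normc z - B by lra.
have /zs[w [ws /=]] : nbhs z [set w | normc (z - w) < normc z - B].
  by apply/nbhs_plane; exists (normc z - B).
have := BP w ws.1; have := sector_norm ws.
have := normc_add (z - w) w; rewrite subrK; rewrite -/(normc _); lra.
Qed.

(** Near K the points of a ray have image of modulus close to 1, hence they lie
    in the thin sectors. *)
Lemma limit_set_sub_sector x e phi : 0 < e -> angle_close e phi (\pi x) ->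
  limit_set K Phi phi `<=` closure (sector x e).
Proof.
move=> e0 [x' [y' [x'P /pi_angleP y'P xy]]] p [pR Kp] V pV.
have [z [[Kz [x'' [r [x''P r1 zE]]]] [Vz zlt]]] := pR _ (filterI pV (Phi_boundary Kp e0)).
have {}zlt := zlt Kz.
exists z; split => //; split => //; exists (x + (x' - y')), r; split.
- by rewrite addrAC subrr add0r.
- by move: zlt; rewrite zE normc_polar; lra.
(* x + (x' - y') represents the angle phi at distance less than e from x. *)
have iy : x'' - (x + (x' - y')) \is a Num.int.
  have -> : x'' - (x + (x' - y')) = (x'' - x') + (y' - x) by ring.
  by rewrite rpredD//; apply/pi_angleP; rewrite x''P.
rewrite zE; congr (_ * _).
have := expi2piD (x'' - (x + (x' - y'))) (x + (x' - y')).
by rewrite subrK (expi2pi_int iy) mul1r.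
Qed.

Lemma impression_sub_prime x :
  impression K Phi (\pi x) `<=` prime_impression x.
Proof.
move=> z zI e e0; apply: (@closed_closure _ (sector x e)).
apply: closure_subset (zI e e0) => w [phi /= phix].
exact: limit_set_sub_sector.
Qed.

Lemma limit_set_sub_impression theta :
  limit_set K Phi theta `<=` impression K Phi theta.
Proof.
move=> z zL e /= e0; apply: subset_closure; exists theta => //.
have [x xE] := angle_repr theta.
by exists x, x; split => //; rewrite subrr normr0.
Qed.

(** The points of the ray with image of modulus below 2 stay in a disc, so they
    accumulate somewhere as the radius decreases to 1; outside K the image of an
    accumulation point would have modulus 1. *)
Lemma limit_set_nonempty theta : limit_set K Phi theta !=set0.
Proof.
have [x xE] := angle_repr theta; have [B BP] := Phi_le2_bounded.
pose f (r : R) : C := Psi (r%:C%C * expi2pi x).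
have fP (r : R) : 1 < r -> ~ K (f r) /\ Phi (f r) = r%:C%C * expi2pi x.
  by move=> r1; apply: PsiP; rewrite normc_polar; lra.
have gt1 : \forall r \near (1 : R)^'+, 1 < r by exact: nbhs_right_gt.
have Fnear a : 1 < a -> (f @ (1 : R)^'+) [set z | ray K Phi theta z /\ normc (Phi z) < a].
  move=> a1; have lta : \forall r \near (1 : R)^'+, r < a by exact: nbhs_right_lt.
  apply: filterS2 gt1 lta => r r1 ra; have [Kf Pf] := fP r r1; split.
    by split => //; exists x, r.
  by rewrite Pf normc_polar; lra.
have PF : ProperFilter (f @ (1 : R)^'+) by exact: fmap_proper_filter.
have [|p [_ pc]] := @compact_disc R B _ PF.
  have := Fnear 2 ltac:(lra); apply: filterS => z [[Kz _] z2].
  by apply: BP => //; exact: ltW.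
exists p; split.
  by move=> V pV; have [z [[rz _] Vz]] := pc _ _ (Fnear 2 ltac:(lra)) pV; exists z.
apply: contrapT => Kp; have p1 := Phi_gt1 Kp.
pose e := (normc (Phi p) - 1) / 2.
have e0 : 0 < e by rewrite /e; lra.
have np : nbhs p [set w | normc (Phi p - Phi w) < e].
  exact: (cvg_planeP (Phi_continuous Kp) e0).
have [|z [[_ ze]]] := pc _ _ (Fnear (1 + e) _) np; first lra.
rewrite /mkset => zp.
by have := normc_add (Phi p - Phi z) (Phi z); rewrite subrK /e in ze zp *; lra.
Qed.

Lemma impression_nonempty theta : impression K Phi theta !=set0.
Proof.
by have [p pL] := limit_set_nonempty theta; exists p; exact: limit_set_sub_impression.
Qed.

(** As points outside K tend to p, their images tend to the unit circle and their
    angles, chosen in the compact interval [0, 1], accumulate at some x. *)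
Lemma boundary_prime_impression p :
  boundary K p -> exists x, prime_impression x p.
Proof.
move=> [/(K_closed) Kp nKp].
have argP z : exists y : R, 0 <= y <= 1 /\
    (~ K z -> Phi z = (normc (Phi z))%:C%C * expi2pi y).
  have [Kz|Kz] := pselect (K z); first by exists 0; split; [lra|].
  have p1 := Phi_gt1 Kz.
  have n0 : (normc (Phi z))%:C%C != 0 :> C by rewrite -normc_gt0 normc_real gtr0_norm; lra.
  have [|y y01 yE] := @expi2pi_surj R (Phi z / (normc (Phi z))%:C%C).
    by rewrite normc_mul normcV normc_real gtr0_norm ?divff; lra.
  by exists y; split => // _; rewrite -yE mulrC divfK.
have [a aP] := choice argP.
pose F := within (~` K) (nbhs p).
have PF : ProperFilter F.
  apply: within_nbhs_proper => V pV; apply: contrapT => nV; apply: nKp.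
  by apply: filterS pV => z Vz; apply: contrapT => Kz; apply: nV; exists z.
have PaF : ProperFilter (a @ F) by exact: fmap_proper_filter.
have [|x [_ xc]] := @segment_compact R 0 1 _ PaF.
  apply: (@filterE _ F _ (a @^-1` `[0, 1]%classic)) => z.
  by rewrite /= in_itv /=; have [] := aP z.
exists x => e /= e0 V pV.
have FA : (a @ F) (a @` [set z | [/\ V z, ~ K z & normc (Phi z) < 1 + e]]).
  rewrite /fmap /= /F /within /=.
  apply: filterS2 pV (Phi_boundary Kp e0) => z Vz ze Kz.
  by exists z => //; split => //; exact: ze.
have [y [[z [Vz Kz ze] zy] /= xy]] := xc _ _ FA (nbhsx_ballx x e e0).
exists z; split => //; split => //; exists (a z), (normc (Phi z)); split.
- by move: xy; rewrite -zy -ball_normE /= distrC.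
- by rewrite (Phi_gt1 Kz).
exact: (aP z).2.
Qed.

Lemma sector_avoids_ray x theta : \pi x <> theta ->
  exists2 e : R, 0 < e & sector x e `&` ray K Phi theta = set0.
Proof.
have [x1 <-] := angle_repr theta.
move=> /pi_angleP /negP nint.
(* e keeps y - x1 strictly between two consecutive integers. *)
pose d := x - x1; pose n := Num.floor d.
have dn : n%:~R < d.
  rewrite lt_neqAle floor_le_tmp andbT; apply: contra nint => /eqP nd.
  by rewrite -[x - x1]nd; exact: intr_int.
have dn1 : d < n%:~R + 1 by rewrite -intrD1 floorD1_gt.
pose e := Num.min (d - n%:~R) (n%:~R + 1 - d).
exists e; first by rewrite lt_min !subr_gt0 dn.
rewrite -subset0 => z [[Kz [y [r [yx r1 zE]]]] [_ [x' [r' [/pi_angleP x'P r'1 zE']]]]].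
have yx' : y - x' \is a Num.int.
  by apply: (@polar_inj R r r'); [lra | lra | rewrite -zE].
have : y - x1 \is a Num.int.
  have -> : y - x1 = (y - x') + (x' - x1) by ring.
  exact: rpredD.
move=> /intrP[m mE].
move: yx; rewrite /e lt_min !ltr_norml => /andP[/andP[ya yb] /andP[yc yd]].
have nm : n%:~R < m%:~R :> R by rewrite -mE; move: dn dn1 ya yb yc yd; rewrite /d; lra.
have mn : m%:~R < (n + 1)%:~R :> R.
  by rewrite intrD1 -mE; move: dn dn1 ya yb yc yd; rewrite /d; lra.
move: nm mn; rewrite !ltr_int ltzD1 => nm mn.
by have := lt_le_trans nm mn; rewrite ltxx.
Qed.

(** * Separation lines and fibers *)

Section Fibers.
Variable Q : set (angle R).
Local Notation separation_line := (separation_line K Phi Q).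
Local Notation separated := (Defs.separated K Phi Q).
Local Notation fiber := (fiber K Phi Q).

Lemma limit_set_closureC theta p :
  limit_set K Phi theta p -> closure (~` K) p.
Proof. by move=> [pR _]; apply: closure_subset pR => z []. Qed.

Lemma lands_limit_set theta p : lands_at K Phi theta p -> limit_set K Phi theta p.
Proof. by move=> ->. Qed.

Lemma interior_arc_sub theta1 theta2 c p1 p2 t :
  lands_at K Phi theta1 p1 -> lands_at K Phi theta2 p2 ->
  interior_arc K c p1 p2 -> 0 <= t <= 1 -> K (c t).
Proof.
move=> /lands_limit_set[_ Kp1] /lands_limit_set[_ Kp2] [_ _ c0 c1 ci] /andP[].
rewrite le_eqVlt => /orP[/eqP <-|t0]; first by rewrite c0.
rewrite le_eqVlt => /orP[/eqP ->|t1]; first by rewrite c1.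
by apply: interior_subset; apply: ci; rewrite t0.
Qed.

(** The features of a separation line that decide which points of an impression
    it can separate; they are common to its two kinds. *)
Lemma separation_line_rays g : separation_line g -> exists theta1 theta2,
  [/\ Q theta1 /\ Q theta2,
      g `\` K `<=` ray K Phi theta1 `|` ray K Phi theta2
    & forall p, lands_at K Phi theta1 p \/ lands_at K Phi theta2 p -> g p].
Proof.
case=> [[t1 [t2 [p [Q12 _ [/K_closed Kp _] [l1 l2] ->]]]]|
        [t1 [t2 [p1 [p2 [c [Q12 _ [l1 l2] ca ->]]]]]]]; exists t1, t2; split => //.
- by move=> z [[//|->] Kz].
- move=> q [|]; [rewrite /lands_at l1|rewrite /lands_at l2].
    by move=> /seteqP[/(_ p erefl) <- _]; right.
  by move=> /seteqP[/(_ p erefl) <- _]; right.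
- move=> z [[//|[t t01 <-]] Kz]; exfalso; apply: Kz.
  by apply: (interior_arc_sub l1 l2 ca); move: t01; rewrite /= in_itv.
case: ca => _ _ c0 c1 _ q [|]; [rewrite /lands_at l1|rewrite /lands_at l2].
  move=> /seteqP[/(_ p1 erefl) /= <- _]; right; exists 0 => //.
  by rewrite /= in_itv /= lexx ler01.
move=> /seteqP[/(_ p2 erefl) /= <- _]; right; exists 1 => //.
by rewrite /= in_itv /= lexx ler01.
Qed.

(** A separation line none of whose rays has angle x stays away from the thin
    sectors about x, which therefore join all points of the impression that are
    off the line. *)
Lemma prime_impression_separated x z w :
  prime_impression x z -> prime_impression x w -> separated z w ->
  exists g, [/\ ~ g z, ~ g w, Q (\pi x)
    & forall p, lands_at K Phi (\pi x) p -> g p].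
Proof.
move=> xz xw [g [sg gz gw nc]]; exists g.
have [t1 [t2 [[Q1 Q2] gK gl]]] := separation_line_rays sg.
have [x1|x1] := pselect (\pi x = t1).
  by split => //; [rewrite x1 | move=> p pl; apply: gl; left; rewrite -x1].
have [x2|x2] := pselect (\pi x = t2).
  by split => //; [rewrite x2 | move=> p pl; apply: gl; right; rewrite -x2].
exfalso; apply: nc.
have [e1 e10 se1] := sector_avoids_ray x1.
have [e2 e20 se2] := sector_avoids_ray x2.
pose e := Num.min e1 e2.
have e0 : 0 < e by rewrite lt_min e10.
have sg0 v : sector x e v -> ~ g v.
  move=> sv gv; have [rv|rv] := gK v (conj gv sv.1).
    have : set0 v by rewrite -se1; split => //; apply: sector_sub sv; rewrite ge_min lexx.
    by [].
  have : set0 v by rewrite -se2; split => //; apply: sector_sub sv; rewrite ge_min lexx orbT.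
  by [].
exists (sector x e `|` [set z; w]); last by right; right.
split; first by right; left.
  by move=> v [/sg0//|[->|->]].
apply: (connected_between (@sector_connected x e e0)); first by move=> v; left.
by move=> v [/subset_closure//|[->|->]]; [exact: xz | exact: xw].
Qed.

Lemma fiber_sub z : fiber z `<=` [set w | K w /\ ~ separated z w].
Proof. exact: connected_component_sub. Qed.

Lemma separated_irrefl z : ~ separated z z.
Proof. by move=> [g [_ gz _]]; apply; exact: connected_component_refl. Qed.

Lemma fiber_refl z : K z -> fiber z z.
Proof.
by move=> Kz; apply: connected_component_refl; split => //; exact: separated_irrefl.
Qed.

Hypothesis Q_lands : forall theta, Q theta -> lands K Phi theta.

(** If x is not an angle of Q, no two points of the impression are separated.
    Otherwise the landing point p of the ray lies in the impression and on every
    line that uses the ray, so nothing in the impression is separated from p. *)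
Lemma prime_impression_in_fiber x :
  exists2 z, K z & prime_impression x `<=` fiber z.
Proof.
have sub z : prime_impression x z ->
    (forall w, prime_impression x w -> ~ separated z w) ->
    exists2 z, K z & prime_impression x `<=` fiber z.
  move=> xz nsep; exists z; first exact: prime_impression_sub xz.
  apply: connected_component_max => //; last exact: prime_impression_connected.
  by move=> w xw; split; [exact: prime_impression_sub xw | exact: nsep].
have [Qx|nQx] := pselect (Q (\pi x)).
  have [p pl] := Q_lands Qx.
  have xp : prime_impression x p.
    apply: impression_sub_prime; apply: limit_set_sub_impression.
    exact: lands_limit_set.
  apply: (sub p) => // w xw sep.
  have [g [gp _ _ gl]] := prime_impression_separated xp xw sep.
  exact: gp (gl p pl).
have [z /impression_sub_prime xz] := impression_nonempty (\pi x).
by apply: (sub z) => // w xw /(prime_impression_separated xz xw)[g [_ _ /nQx]].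
Qed.

(** A line that meets K at z, away from the landing points, does so in the part
    of its arc inside K.  A homeomorphism supported in a small disc about z takes
    a point y off the line to z; it takes the line to one that avoids z, and still
    separates w from w' because it fixes both. *)
Lemma move_separation_line g z w w' : separation_line g -> g z -> K z ->
  (forall theta p, Q theta -> lands_at K Phi theta p -> p <> z) ->
  ~ g w -> ~ g w' -> ~ connected_component (~` g) w w' ->
  exists g', [/\ separation_line g', ~ g' z, ~ g' w, ~ g' w'
    & ~ connected_component (~` g') w w'].
Proof.
move=> sg gz Kz znl gw gw' ncc.
case: sg => [[t1 [t2 [p [[Q1 _] _ _ [l1 _] gE]]]]|].
  exfalso; move: gz; rewrite gE => -[[[nKz _]|[nKz _]]|/= zp] //.
  by apply: (znl _ _ Q1 l1); rewrite zp.
move=> [t1 [t2 [p1 [p2 [c [[Q1 Q2] p12 [l1 l2] [cc cI c0 c1 ci] gE]]]]]].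
have zint : interior K z.
  move: gz; rewrite gE => -[[[nKz _]|[nKz _]]|[t + ct]] //.
  rewrite /= in_itv /= -ct => /andP[].
  rewrite le_eqVlt => /orP[/eqP t0|t0].
    by exfalso; apply: (znl _ _ Q1 l1); rewrite -ct -t0.
  rewrite le_eqVlt => /orP[/eqP t1'|t1'].
    by exfalso; apply: (znl _ _ Q2 l2); rewrite -ct t1'.
  by apply: ci; rewrite t0.
(* A disc about z inside K that avoids w and w'. *)
have ne_nbhs v : ~ g v -> nbhs z (~` [set v]).
  move=> gv; have vz : 0 < normc (z - v).
    by rewrite normc_gt0 subr_eq0; apply: contra_notN gv => /eqP <-.
  by apply/nbhs_plane; exists (normc (z - v)) => // u /[swap] ->; rewrite ltxx.
have : nbhs z (interior K `&` (~` [set w] `&` ~` [set w'])).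
  by apply: filterI; [exact: nbhs_interior | apply: filterI; exact: ne_nbhs].
move=> /nbhs_plane[r r0 rP].
have r40 : 0 < r / 4 by lra.
have : nbhs z [set v | normc (z - v) < r / 4] by apply/nbhs_plane; exists (r / 4).
move=> /(arc_complement_dense cc cI)[y /= zy ny].
have yz : normc (z - y) < r / 2 by move: zy; rewrite -/(normc _); lra.
have [h [k [ch ck hk kh [hy hid]]]] := push_homeomorphism yz.
have disc v : normc (v - y) < r / 2 -> [/\ interior K v, v <> w & v <> w'].
  move=> vy; have zv : normc (z - v) < r.
    have := normc_add (z - y) (y - v); rewrite subrKA (normc_sub y v).
    by move: zy vy; rewrite -!/(normc _); lra.
  by have [i1 [n1 n2]] := rP v zv.
have hfix v : ~ interior K v -> h v = v.
  by move=> nv; apply: hid; rewrite leNgt; apply/negP => /disc[].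
have hw : h w = w by apply: hid; rewrite leNgt; apply/negP => /disc[].
have hw' : h w' = w' by apply: hid; rewrite leNgt; apply/negP => /disc[].
have hint v : interior K v -> interior K (h v).
  move=> Kv; have [/disc[]//|out] := ltrP (normc (h v - y)) (r / 2).
  have : h (h v) = h v by exact: hid.
  by move/(can_inj hk) => ->.
have hray theta v : ray K Phi theta v -> h v = v.
  by move=> [nKv _]; apply: hfix => /interior_subset.
have hland theta p : lands_at K Phi theta p -> h p = p.
  move=> /lands_limit_set/limit_set_closureC pc; apply: hfix => pK.
  by have [u []] := pc _ pK.
pose g' := ray K Phi t1 `|` ray K Phi t2 `|` (h \o c) @` `[0, 1].
have g'g v : g' v -> g (k v).
  rewrite gE => -[[rv|rv]|[t t01 <-]].
  - by left; left; rewrite -(hray _ _ rv) hk.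
  - by left; right; rewrite -(hray _ _ rv) hk.
  by right; exists t => //=; rewrite hk.
have gg' v : g v -> g' (h v).
  rewrite gE => -[[rv|rv]|[t t01 <-]]; last by right; exists t.
    by left; left; rewrite (hray _ _ rv).
  by left; right; rewrite (hray _ _ rv).
have ky : k z = y by rewrite -hy hk.
have kw : k w = w by rewrite -hw hk.
have kw' : k w' = w' by rewrite -hw' hk.
have y0 : normc (y - y) < r / 2 by rewrite subrr normc0; lra.
have ngy : ~ g y.
  rewrite gE => -[[ry|ry]|//].
    by apply: ry.1; apply: interior_subset; have [] := disc y y0.
  by apply: ry.1; apply: interior_subset; have [] := disc y y0.
exists g'; split.
- right; exists t1, t2, p1, p2, (h \o c).
  split; [by split | exact: p12 | by split | split | by []].
  + by move=> t; exact: (cvg_comp _ _ (cc t) (ch (c t))).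
  + by move=> s t s01 t01 /= /(can_inj hk); exact: cI.
  + by rewrite /= c0; exact: hland l1.
  + by rewrite /= c1; exact: hland l2.
  + by move=> t t01; apply: hint; exact: ci.
- by move=> /g'g; rewrite ky.
- by move=> /g'g; rewrite kw.
- by move=> /g'g; rewrite kw'.
move=> [B [Bw Bg' coB] Bw']; apply: ncc; exists (k @` B); last by exists w'.
split; first by exists w.
  by move=> _ [v Bv <-]; move: (Bg' v Bv); apply: contra_not => /gg'; rewrite kh.
by apply: (connected_continuous_connected coB); exact: (continuous_subspaceT ck).
Qed.

(** Points of one fiber are pairwise not separated.  A line through the centre z
    of the fiber that separated two of them would meet z at a landing point,
    whose fiber is trivial, or inside the interior arc, from which it can be
    moved away; and a line that misses z would separate z from one of them. *)
Lemma fiber_not_separated z w w' :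
  (forall theta p, Q theta -> lands_at K Phi theta p ->
     trivial_fiber K Phi Q p) ->
  K z -> fiber z w -> fiber z w' -> ~ separated w w'.
Proof.
move=> triv Kz zw zw' [g [sg gw gw' ncc]].
have znl theta p : Q theta -> lands_at K Phi theta p -> g z -> p <> z.
  move=> Qt pl gz pz; move: (triv theta p Qt pl) zw; rewrite pz => -> wz.
  by apply: gw; rewrite wz.
have [g' [sg' gz' gw1 gw1' ncc']] : exists g', [/\ separation_line g', ~ g' z,
    ~ g' w, ~ g' w' & ~ connected_component (~` g') w w'].
  have [gz|gz] := pselect (g z); last by exists g.
  by apply: (move_separation_line sg gz Kz) => // theta p Qt pl; exact: znl Qt pl gz.
have [_ nzw] := fiber_sub zw; have [_ nzw'] := fiber_sub zw'.
have czw : connected_component (~` g') z w.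
  by apply: contrapT => nc; apply: nzw; exists g'.
have czw' : connected_component (~` g') z w'.
  by apply: contrapT => nc; apply: nzw'; exists g'.
apply: ncc'; apply: connected_component_trans czw'.
exact: connected_component_sym.
Qed.

End Fibers.

End RiemannMap.

Theorem lemma2p7 (R : realType) (K : set (plane R))
  (Phi : plane R -> plane R) (Q : set (angle R))
  (K_compact : compact K) (K_connected : connected K) (K_full : full K)
  (K_nondegenerate : exists z w, [/\ K z, K w & z <> w])
  (Phi_riemann : riemann_map K Phi)
  (Q_countable : countable Q)
  (Q_lands : forall theta, Q theta -> lands K Phi theta)
  (Q_trivial : forall theta p, Q theta -> lands_at K Phi theta p ->
     trivial_fiber K Phi Q p) :
  [/\ forall z w, K z -> K w ->
        fiber K Phi Q z = fiber K Phi Q w \/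
        fiber K Phi Q z `&` fiber K Phi Q w = set0,
      partition (fibers K Phi Q) id K /\
      (forall z, K z ->
        fiber K Phi Q z = [set w | K w /\ fiber K Phi Q w = fiber K Phi Q z])
    & exists f : angle R -> set (plane R),
        [/\ forall theta, fibers K Phi Q (f theta) /\
              impression K Phi theta `<=` f theta,
            forall theta F, fibers K Phi Q F ->
              impression K Phi theta `<=` F -> F = f theta
          & range f =
            [set F | fibers K Phi Q F /\ F `&` boundary K !=set0]]].
Proof.
pose fib := fiber K Phi Q.
have fibK z w : fib z w -> K w by move=> /fiber_sub[].
have refl z : K z -> fib z z by exact: fiber_refl.
(* A fiber is a connected set of points none of which is separated from any
   point of it. *)
have half z w : K z -> fib z w -> fib z `<=` fib w.
  move=> Kz zw; apply: connected_component_max => //.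
    move=> v zv; split; first exact: fibK zv.
    exact: fiber_not_separated Q_trivial Kz zw zv.
  exact: component_connected.
have same z w : K z -> fib z w -> fib w = fib z.
  move=> Kz zw; have sub := half z w Kz zw; apply/seteqP; split => //.
  exact: half (fibK _ _ zw) (sub z (refl z Kz)).
have disj z w : K z -> K w -> fib z = fib w \/ fib z `&` fib w = set0.
  move=> Kz Kw.
  have [->|/set0P[v [zv wv]]] := eqVneq (fib z `&` fib w) set0; first by right.
  by left; rewrite -(same z v Kz zv) (same w v Kw wv).
have fibs_eq F G p : fibers K Phi Q F -> fibers K Phi Q G -> F p -> G p -> F = G.
  move=> [z Kz <-] [w Kw <-] zp wp.
  by rewrite -/(fib z) -(same z p Kz zp) (same w p Kw wp).
split => //.
  split.
    split.
    - apply/seteqP; split => [w [_ [z Kz <-]] /fibK//|z Kz].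
      by exists (fib z); [exists z | exact: refl].
    - by move=> F G FF FG [p [Fp Gp]]; exact: fibs_eq Fp Gp.
    - by move=> _ [z Kz <-]; exists z; exact: refl.
  move=> z Kz; apply/seteqP; split => w.
    by move=> zw; split; [exact: fibK zw | exact: same zw].
  by move=> [Kw <-]; exact: refl.
have [f0 f0P] : exists f0 : R -> set (plane R), forall x,
    fibers K Phi Q (f0 x) /\ prime_impression K Phi x `<=` f0 x.
  suff pick (x : R) :
      exists F, fibers K Phi Q F /\ prime_impression K Phi x `<=` F.
    by have [f0 f0P] := choice pick; exists f0.
  have [z Kz zP] := prime_impression_in_fiber K_compact Phi_riemann Q_lands x.
  by exists (fib z); split => //; exists z.
pose f (theta : angle R) := f0 (repr theta).
have fP theta : fibers K Phi Q (f theta) /\ impression K Phi theta `<=` f theta.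
  have [fF sub] := f0P (repr theta); split => //.
  apply: subset_trans sub; rewrite -{1}[theta]reprK.
  exact: (impression_sub_prime K_compact Phi_riemann).
have funiq theta F : fibers K Phi Q F -> impression K Phi theta `<=` F -> F = f theta.
  move=> FF sub; have [fF fsub] := fP theta.
  have [p pI] := impression_nonempty Phi_riemann theta.
  by apply: fibs_eq (sub p pI) (fsub p pI).
exists f; split => //.
apply/seteqP; split => [_ [theta _ <-]|F [FF [p [Fp pb]]]].
  have [fF fsub] := fP theta; split => //.
  have [p pI] := impression_nonempty Phi_riemann theta.
  exists p; split; first exact: fsub.
  apply: (prime_impression_boundary Phi_riemann (x := repr theta)).
  by apply: impression_sub_prime => //; rewrite reprK.
have [x xp] := boundary_prime_impression K_compact Phi_riemann pb.
exists (\pi x) => //; have [fF fsub] := fP (\pi x).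
have [f0F f0sub] := f0P x.
have -> : f (\pi x) = f0 x.
  apply/esym; apply: funiq => //; apply: subset_trans f0sub.
  exact: impression_sub_prime.
exact: fibs_eq (f0sub p xp) Fp.
Qed.
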